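(* Let $X$ be a real reflexive Banach space, let $K$ be a nonempty, bounded, closed and convex subset of $X$, and let $A:K\to 2^{X^*}$ be a set valued mapping with $A(u)\neq\emptyset$ for all $u\in K$ which is monotone and lower hemicontinuous on $K$. Let $\phi:X\to(-\infty,+\infty]$ be convex and lower semicontinuous with $D(\phi)\cap K\neq\emptyset$, let $T:X\to L^p(\Omega;\mathbb{R}^k)$ be linear and compact (write $\hat u=Tu$), and let $j:\Omega\times\mathbb{R}^k\to\mathbb{R}$ be a Carathéodory function, locally Lipschitz with respect to the second variable, for which there exists $C>0$ such that $|z|\leq C(1+|y|^{p-1})$ for a.e. $x\in\Omega$, all $y\in\mathbb{R}^k$ and all $z\in\partial j(x,y)$. Then there exist $u\in K$ and $u^*\in A(u)$ such that $$\langle u^*,v-u\rangle+\phi(v)-\phi(u)+\int_\Omega j^0(x,\hat u(x);\hat v(x)-\hat u(x))\,dx\geq 0\quad\text{for all } v\in K.$$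
   Context: Setting: $X$ is a real reflexive Banach space with dual $X^*$ and duality pairing $\langle\cdot,\cdot\rangle$; $1<p<\infty$; $\Omega$ is a bounded open subset of $\mathbb{R}^N$; $k\geq 1$; $|\cdot|$ is the Euclidean norm and ''$\cdot$'' the inner product on $\mathbb{R}^k$. $$j^0(x,y;h)=\limsup_{w\to y,\ \lambda\downarrow 0}\frac{j(x,w+\lambda h)-j(x,w)}{\lambda}$$ is Clarke's generalized directional derivative of $j(x,\cdot)$ at $y$ in the direction $h$, and $\partial j(x,y)=\{z\in\mathbb{R}^k: z\cdot h\leq j^0(x,y;h)\text{ for all }h\in\mathbb{R}^k\}$ is Clarke's generalized gradient of $j(x,\cdot)$ at $y$. $D(\phi)=\{u\in X:\phi(u)<+\infty\}$. The inequality is understood to hold trivially for those $v$ with $v\notin D(\phi)$ when $u\in D(\phi)$; no $u\notin D(\phi)$ satisfies it (test with $v\in K\cap D(\phi)$). A set valued mapping $A:K\to 2^{X^*}$ is monotone on $K$ if $\langle v^*-u^*,v-u\rangle\geq 0$ for all $u,v\in K$, $u^*\in A(u)$, $v^*\in A(v)$. It is lower hemicontinuous on $K$ if its restriction to every line segment of $K$ is lower semicontinuous with respect to the weak-star topology of $X^*$, i.e. for every line segment $L\subset K$, every $u\in L$, every $u^*\in A(u)$ and every sequence $(u_n)\subset L$ with $u_n\to u$, there exist $u_n^*\in A(u_n)$ such that $u_n^*$ converges weakly-star to $u^*$. *)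

(* Defs.v *)
From HB Require Import structures.
From mathcomp Require Import all_boot all_order all_algebra.
From mathcomp Require Import all_classical all_reals all_analysis.

Set Implicit Arguments.
Unset Strict Implicit.
Unset Printing Implicit Defensive.

Import Order.TTheory GRing.Theory Num.Theory.
Import numFieldNormedType.Exports.

Local Open Scope classical_set_scope.
Local Open Scope ring_scope.

(** * Euclidean structure of R^k

    The library norm on ['rV[R]_k] is the sup norm: it induces the same open
    sets, bounded sets and locally Lipschitz functions as the Euclidean one, so
    it is only where the value of a norm matters that [enorm] is used. *)

Definition edot (R : realType) (k : nat) (y z : 'rV[R]_k) : R :=
  \sum_(i < k) y ord0 i * z ord0 i.

Definition enorm (R : realType) (k : nat) (y : 'rV[R]_k) : R :=
  Num.sqrt (edot y y).

(** * Lebesgue measure on R^N, N >= 1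

    The Lebesgue outer measure is the infimum of the total volumes of countable
    covers by boxes [prod_i [a_i, b_i[]; its Caratheodory sigma-algebra is the
    Lebesgue sigma-algebra. *)

Section lebesgue_rV.
Context (R : realType) (N : nat).
Implicit Types (ab : 'rV[R]_N.+1 * 'rV[R]_N.+1) (A : set 'rV[R]_N.+1).

Definition box ab : set 'rV[R]_N.+1 :=
  [set x | forall i, ab.1 ord0 i <= x ord0 i < ab.2 ord0 i].

Definition box_volume ab : R :=
  \prod_(i < N.+1) Num.max 0 (ab.2 ord0 i - ab.1 ord0 i).

Local Open Scope ereal_scope.

Definition lebesgue_outer A : \bar R :=
  ereal_inf [set \sum_(k <oo) (box_volume (B k))%:E |
             B in [set B : nat -> 'rV[R]_N.+1 * 'rV[R]_N.+1 |
                   A `<=` \bigcup_k box (B k)]].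

Lemma box_volume_ge0 ab : 0 <= (box_volume ab)%:E.
Proof. by rewrite lee_fin prodr_ge0// => i _; rewrite le_max lexx. Qed.

Lemma lebesgue_outer_ge0 A : 0 <= lebesgue_outer A.
Proof.
apply: le_ereal_inf_tmp => _ [B _ <-].
by apply: nneseries_ge0 => *; exact: box_volume_ge0.
Qed.

Lemma le_lebesgue_outer : {homo lebesgue_outer : A B / A `<=` B >-> A <= B}.
Proof.
move=> A B AB; apply/ereal_inf_le_tmp => _ [C BC <-].
by exists C => //; exact: subset_trans BC.
Qed.

Lemma lebesgue_outer0 : lebesgue_outer set0 = 0.
Proof.
apply/eqP; rewrite eq_le lebesgue_outer_ge0 andbT.
apply: ereal_inf_lbound; exists (fun=> (0, 0)%R) => //.
apply: eseries0 => k _ _.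
by rewrite /box_volume big_ord_recl/= mxE subr0 maxxx mul0r.
Qed.

Lemma lebesgue_outer_sigma_subadditive : sigma_subadditive lebesgue_outer.
Proof.
move=> A; have [[i ioo]|] := pselect (exists i, lebesgue_outer (A i) = +oo).
  rewrite (eseries_pinfty _ _ ioo) ?leey// => n _.
  by rewrite -ltNye (lt_le_trans _ (lebesgue_outer_ge0 _)).
rewrite -forallNE => Aoo.
suff add2e (e : {posnum R}) : lebesgue_outer (\bigcup_n A n) <=
    \sum_(i <oo) lebesgue_outer (A i) + e%:num%:E.
  by apply/lee_addgt0Pr => _/posnumP[].
rewrite (le_trans _ (epsilon_trick _ _ _))//; last first.
  by move=> n; exact: lebesgue_outer_ge0.
pose P n (B : nat -> 'rV[R]_N.+1 * 'rV[R]_N.+1) :=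
  A n `<=` \bigcup_k box (B k) /\
  \sum_(k <oo) (box_volume (B k))%:E <=
    lebesgue_outer (A n) + (e%:num / (2 ^ n.+1)%:R)%:E.
have [G PG] : {G : nat -> nat -> _ & forall n, P n (G n)}.
  apply: (@choice _ _ P) => n; rewrite /P /lebesgue_outer.
  set S := (X in ereal_inf X); move infS : (ereal_inf S) => iS.
  case: iS infS => [r Sr|Soo|Soo].
  - have en1 : (0 < e%:num / (2 ^ n.+1)%:R)%R by [].
    have /(lb_ereal_inf_adherent en1) : ereal_inf S \is a fin_num by rewrite Sr.
    move=> [x [B AnB muBx] xS].
    by exists B; split => //; rewrite muBx -Sr; exact/ltW.
  - by have := Aoo n; rewrite /lebesgue_outer Soo.
  - suff : lbound S 0 by move/le_ereal_inf_tmp; rewrite Soo.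
    move=> /= _ [B AnB <-].
    by apply: nneseries_ge0 => *; exact: box_volume_ge0.
pose v (ij : nat * nat) : \bar R := (box_volume (G ij.1 ij.2))%:E.
have v_ge0 ij : 0 <= v ij by exact: box_volume_ge0.
apply: (@le_trans _ _ (\esum_(i in setT) v i)).
  apply: ereal_inf_lbound => /=.
  have /card_esym/ppcard_eqP[f] := card_nat2.
  exists (fun i => G (f i).1 (f i).2).
    move=> t [i _ /(PG i).1 [j _ Gt]].
    by exists (f^-1%FUN (i, j)) => //=; rewrite invK ?inE.
  rewrite -(esum_pred_image v _ xpredT) ?[fun=> _]set_true//.
  by rewrite image_eq.
rewrite (_ : esum _ _ = \sum_(i <oo) \sum_(j <oo) v (i, j)); last first.
  pose J : nat -> set (nat * nat) := fun i => [set (i, j) | j in setT].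
  rewrite (_ : setT = \bigcup_k J k); last first.
    by rewrite predeqE => -[a b]; split => // _; exists a => //; exists b.
  rewrite esum_bigcupT /=; last 2 first.
    - apply/trivIsetP => i j _ _ ij.
      rewrite predeqE => -[n m] /=; split => //= -[] [_] _ [<-{n} _].
      by move=> [m' _] [] /esym/eqP; rewrite (negbTE ij).
    - by move=> /= [n m]; exact: v_ge0.
  rewrite -(image_id [set: nat]) -fun_true esum_pred_image//; last first.
    by move=> n _; exact: esum_ge0.
  apply: eq_eseriesr => /= j _.
  rewrite -(esum_pred_image v (pair j) predT)//=; last first.
    by move=> ? ? _ _; exact: (@can_inj _ _ _ snd).
  by congr esum; rewrite predeqE => -[a b]; split; move=> [i _ <-]; exists i.
apply: lee_lim.
- apply: is_cvg_nneseries => n *.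
  by apply: nneseries_ge0 => m *; exact: (v_ge0 (n, m)).
- apply: is_cvg_nneseries => n *.
  by apply: adde_ge0 => //; exact: lebesgue_outer_ge0.
- by near=> n; apply: lee_sum => i _; exact: (PG i).2.
Unshelve. all: by end_near. Qed.

HB.instance Definition _ := isOuterMeasure.Build R 'rV[R]_N.+1 lebesgue_outer
  lebesgue_outer0 lebesgue_outer_ge0 le_lebesgue_outer
  lebesgue_outer_sigma_subadditive.

Notation lebesgue_rV_type :=
  (caratheodory_type [the {outer_measure set 'rV[R]_N.+1 -> \bar R} of
                      lebesgue_outer]).

Definition lebesgue_rV : set lebesgue_rV_type -> \bar R := lebesgue_outer.

HB.instance Definition _ := isMeasure.Build _ lebesgue_rV_type R lebesgue_rV
  (@caratheodory_measure0 R _ lebesgue_outer)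
  (@caratheodory_measure_ge0 R _ lebesgue_outer)
  (@caratheodory_measure_sigma_additive R _ lebesgue_outer).

End lebesgue_rV.

Notation lebesgue_rV_type R N :=
  (caratheodory_type [the {outer_measure set 'rV[R]_N.+1 -> \bar R} of
                      @lebesgue_outer R N]).
Arguments lebesgue_rV : clear implicits.

(** * Dual space, reflexivity, set-valued mappings *)

Section dual.
Context (R : realType) (X : normedModType R).

(** The dual is the set of continuous linear forms, so that the duality pairing
    [<f, x>] is the application [f x]. *)
Definition dual : set (X -> R) := [set f : X -> R | scalar f /\ continuous f].

Definition dual_norm (f : X -> R) : R :=
  sup [set `|f x| | x in [set x : X | `|x| <= 1]].

(** The canonical embedding of [X] into its bidual is onto. *)
Definition reflexive_space : Prop :=
  forall F : (X -> R) -> R,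
    (forall (a : R) (f g : X -> R), dual f -> dual g ->
       F (fun x => a * f x + g x) = a * F f + F g) ->
    (exists M : R, forall f, dual f -> `|F f| <= M * dual_norm f) ->
    exists x : X, forall f, dual f -> F f = f x.

Definition monotone_on (K : set X) (A : X -> set (X -> R)) : Prop :=
  forall (u v : X) (us vs : X -> R), K u -> K v -> A u us -> A v vs ->
    0 <= vs (v - u) - us (v - u).

Definition line_segment (a b : X) : set X :=
  [set (1 - t) *: a + t *: b | t in `[0, 1]%classic].

Definition lower_hemicontinuous_on (K : set X) (A : X -> set (X -> R)) : Prop :=
  forall a b : X, line_segment a b `<=` K ->
  forall (u : X) (us : X -> R) (u_ : nat -> X),
    line_segment a b u -> A u us ->
    (forall n, line_segment a b (u_ n)) -> u_ @ \oo --> u ->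
    exists us_ : nat -> X -> R, (forall n, A (u_ n) (us_ n)) /\
      forall w : X, us_ n w @[n --> \oo] --> us w.

Definition convex_ereal (phi : X -> \bar R) : Prop :=
  forall (u v : X) (t : R), 0 < t < 1 ->
    (phi (t *: u + (1 - t) *: v)%R <= t%:E * phi u + (1 - t)%:E * phi v)%E.

(** In [\bar R] the library has [+oo - +oo = -oo] and [-oo] absorbs under
    addition: for a real number [c], an inequality
    [0 <= c + phi v - phi u] fails as soon as [phi u = +oo], and holds when
    [phi v = +oo] and [phi u] is finite. *)
Definition effective_domain (phi : X -> \bar R) : set X := [set u | (phi u < +oo)%E].

End dual.

(** * Clarke's generalized derivative and gradient *)

Section clarke.
Context (R : realType) (k : nat).
Implicit Types (f : 'rV[R]_k -> R) (y z h : 'rV[R]_k).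

Definition locally_lipschitz f : Prop :=
  forall y, exists2 U, nbhs y U & [lipschitz f w | w in U].

(** The limsup along [w -> y] and [l -> 0, l > 0]; it is a real number when [f]
    is locally Lipschitz. *)
Definition clarke_derivative f y h : \bar R :=
  limf_esup
    (fun wl : 'rV[R]_k * R => ((f (wl.1 + wl.2 *: h) - f wl.1) / wl.2)%:E)
    (filter_prod (nbhs y) 0^'+).

Definition clarke_gradient f y : set 'rV[R]_k :=
  [set z | forall h, ((edot z h)%:E <= clarke_derivative f y h)%E].

End clarke.

(** * L^p(Omega; R^k) and operators into it

    An element of L^p is given by a representative, two representatives being
    identified when they are equal almost everywhere on [Omega]; accordingly an
    operator [T] into L^p picks a representative [T u] for each [u], and its
    linearity is an equality almost everywhere. *)

Section Lp.
Context (R : realType) (N k : nat).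
Local Notation mu := (lebesgue_rV R N).
Implicit Types (Omega : set (lebesgue_rV_type R N)) (p : R).
Implicit Types f g : lebesgue_rV_type R N -> 'rV[R]_k.

Definition caratheodory_function Omega
    (j : lebesgue_rV_type R N -> 'rV[R]_k -> R) : Prop :=
  (forall y, measurable_fun Omega (fun x => j x y)) /\
  {ae mu, forall x, Omega x -> continuous (j x)}.

Definition Lp_norm Omega p f : \bar R :=
  ('N[mu]_(p%:E)[(fun x => (enorm (f x))%:E) \_ Omega])%E.

Definition in_Lp Omega p f : Prop :=
  (forall i, measurable_fun Omega (fun x => f x ord0 i)) /\
  (Lp_norm Omega p f < +oo)%E.

Context (X : normedModType R).
Implicit Type T : X -> lebesgue_rV_type R N -> 'rV[R]_k.

Definition Lp_linear Omega p T : Prop :=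
  (forall u, in_Lp Omega p (T u)) /\
  forall (a : R) (u v : X),
    {ae mu, forall x, Omega x -> T (a *: u + v) x = a *: T u x + T v x}.

(** Bounded sequences are mapped to sequences with a convergent subsequence. *)
Definition Lp_compact Omega p T : Prop :=
  forall u_ : nat -> X, bounded_set (range u_) ->
    exists (s : nat -> nat) f, {homo s : m n / (m < n)%N} /\
      in_Lp Omega p f /\
      Lp_norm Omega p (fun x => T (u_ (s n)) x - f x) @[n --> \oo] --> 0%E.

End Lp.

(* Main.v *)
Require Import Defs.
From mathcomp Require Import all_boot all_order all_algebra zify.

(** The solutions are found by Minty's method. Write [J u v] for the integral of
    Clarke's derivative of [j x] at [T u x] along [T v x - T u x]. A point [u] is
    tested by each [v] in [K] with [phi v] finite and each [vs] in [A v] through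
    the inequality [phi u <= vs (v - u) + phi v + J u v], in which the form is
    taken at [v] and not at [u].

    Finitely many tests can be passed together. On the convex hull of their base
    points this is the theorem of Knaster, Kuratowski and Mazurkiewicz ([KKM]),
    whose covering hypothesis follows from the monotonicity of [A], the convexity
    of [phi] and the sublinearity of Clarke's derivative ([minty_finite]).
    As [A] need not derive from a potential, minimization is no substitute for
    such a topological principle. It is obtained from the combinatorial lemma of
    Scarf ([scarf]), a form of Sperner's lemma that needs no triangulation.

    All the tests can be passed together by weak compactness. In a reflexive
    space an ultrafilter on a bounded set has a weak limit that lies in the
    closure of each of its convex members ([reflexive_ultrafilter]); this rests
    on the Hahn-Banach theorem, derived here from the existence of minimal
    sublinear functionals. The compact operator [T] maps the ultrafilter to one
    that converges in L^p ([operator_weak_cvg]), and [J] is upper semicontinuous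
    for L^p convergence of [T u] ([clarke_integral_usc]), by dominated
    convergence and the growth condition. A test passed along the ultrafilter is
    therefore passed by its limit ([minty_solution]).

    Finally let [u] pass all the tests, [us] be any element of [A u] and [v] a
    point of [K]. The tests at points [w] of the segment from [u] to [v], with
    forms that tend to [us] as [w] tends to [u], give the inequality with [us]
    after division by the length of the step ([hemivariational_solution]). *)

Set Implicit Arguments.
Unset Strict Implicit.
Unset Printing Implicit Defensive.

(** * Dominant sets *)

Section dominant_sets.
Context (V I : finType) (r : I -> V -> nat).
Hypothesis r_inj : forall i, injective (r i).
Implicit Types (s t : {set V}).

(** Scarf's substitute for a triangulation. With one order for each color, the
    dominant sets form a complex whose top cells are those with as many elements
    as there are colors. *)
Definition dominant s :=
  [forall y, exists i, forall x in s, r i y <= r i x].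

Lemma dominantP s :
  reflect (forall y, exists i, forall x, x \in s -> r i y <= r i x) (dominant s).
Proof.
apply: (iffP forallP) => H y.
  by have /existsP[i /forall_inP Hi] := H y; exists i.
by have [i Hi] := H y; apply/existsP; exists i; apply/forall_inP.
Qed.

Lemma dominantS s t : t \subset s -> dominant s -> dominant t.
Proof.
move=> /subsetP ts /dominantP sD; apply/dominantP => y.
by have [i Hi] := sD y; exists i => x /ts; exact: Hi.
Qed.

Definition cofacets t := [set x | x \notin t & dominant (x |: t)].

(** Candidates for taking over the minimum of [t] in the order [i]. *)
Definition above t i :=
  [set y | [forall j, (j != i) ==> [exists x in t, r j x < r j y]]].

Lemma aboveP t i y :
  reflect (forall j, j != i -> exists2 x, x \in t & r j x < r j y)
          (y \in above t i).
Proof.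
rewrite inE; apply: (iffP forallP) => H j.
  by move=> ji; have := H j; rewrite ji => /exists_inP.
by apply/implyP => ji; apply/exists_inP; apply: H.
Qed.

(** The complex of dominant sets has no branching and no boundary here. Mapping a
    color to the minimum of [t] in its order is onto [t], and [t] has one element
    less than there are colors, so exactly two colors [a] and [b] share their
    minimum. A point then completes [t] to a dominant set exactly if it is the
    greatest element of [above t a] in the order [a], or likewise for [b]. *)
Lemma card_cofacets t : t != set0 -> #|t|.+1 = #|I| -> dominant t ->
  (forall i, above t i != set0) -> #|cofacets t| = 2.
Proof.
move=> /set0Pn[x0 x0t] tI /dominantP tD tN.
pose m i := [arg min_(x < x0 in t) r i x].
have mt i : m i \in t by rewrite /m; case: arg_minnP.
have mle i x : x \in t -> r i (m i) <= r i x.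
  by rewrite /m; case: arg_minnP => // z zt zle; exact: zle.
have mE i x : x \in t -> (forall z, z \in t -> r i x <= r i z) -> x = m i.
  by move=> xt xle; apply: (r_inj (i := i)); apply/eqP; rewrite eqn_leq xle//= mle.
have msurj x : x \in t -> exists i, x = m i.
  by move=> xt; have [i Hi] := tD x; exists i; exact: mE.
have [a [b [ab mab]]] : exists a b, a != b /\ m a = m b.
  have : ~~ injectiveb m.
    apply/negP => /injectiveP /card_imset Hc.
    have : #|m @: I| <= #|t|.
      by apply: subset_leq_card; apply/subsetP => _ /imsetP[i _ ->].
    by rewrite Hc -tI ltnn.
  by case/injectivePn => a [b ab mab]; exists b, a; rewrite eq_sym.
have msurj' i x : (i == a) || (i == b) -> x \in t -> exists2 j, j != i & x = m j.
  move=> iab /msurj[j ->]; have [ji|] := eqVneq j i; last by exists j.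
  case/orP: iab => /eqP iab; first by exists b; rewrite ?iab 1?eq_sym// ji iab.
  by exists a; rewrite ?iab// ji iab.
pose g i := let y0 := odflt x0 [pick y in above t i] in
  [arg max_(y > y0 in above t i) r i y].
have gP i : g i \in above t i /\ forall y, y \in above t i -> r i y <= r i (g i).
  rewrite /g; case: pickP => [y0 y0t|] /=; last first.
    by move=> H; have /set0Pn[y] := tN i; rewrite H.
  by case: arg_maxnP.
have gnt i : (i == a) || (i == b) -> g i \notin t.
  move=> iab; apply/negP => /(msurj' _ _ iab)[j ji gE].
  have /aboveP/(_ _ ji)[z zt] := (gP i).1.
  by rewrite ltnNge {1}gE mle.
have gD i : dominant (g i |: t).
  apply/dominantP => y; have [yM|/aboveP yM] := boolP (y \in above t i).
    exists i => z; rewrite !inE => /predU1P[->|zt]; first exact: (gP i).2.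
    have [j Hj] := tD y; have [<-|ji] := eqVneq j i; first exact: Hj.
    by have /aboveP/(_ _ ji)[w wt] := yM; rewrite ltnNge Hj.
  have [j ji jy] : exists2 j, j != i & forall x, x \in t -> r j y <= r j x.
    have [/exists_inP[j ji /forall_inP jy]|/exists_inPn H] :=
      boolP [exists j in [pred j | j != i], [forall x in t, r j y <= r j x]].
      by exists j.
    exfalso; apply: yM => j ji; have /H := ji.
    by rewrite negb_forall_in => /exists_inP[x xt]; rewrite -ltnNge; exists x.
  exists j => z; rewrite !inE => /predU1P[->|]; last exact: jy.
  have /aboveP/(_ _ ji)[w wt /ltnW] := (gP i).1.
  by apply: leq_trans; exact: jy.
have gab : g a != g b.
  apply/eqP => gab; have [j Hj] := tD (g a).
  have [ja|ja] := eqVneq j a.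
    have jb : j != b by rewrite ja.
    have /aboveP/(_ _ jb)[w wt] := (gP b).1.
    by rewrite -gab ltnNge Hj.
  have /aboveP/(_ _ ja)[w wt] := (gP a).1.
  by rewrite ltnNge Hj.
suff -> : cofacets t = [set g a; g b] by rewrite cards2 gab.
apply/setP => x; rewrite !inE; apply/andP/idP => [[xt /dominantP xD]|]; last first.
  by case/orP => /eqP ->; rewrite gnt ?gD ?eqxx ?orbT.
have [i Hi] := xD x.
have lti z : z \in t -> r i x < r i z.
  move=> zt; rewrite ltn_neqAle Hi ?inE ?zt ?orbT// andbT.
  by apply: contra xt => /eqP/r_inj ->.
have mi w : w \in t ->
    exists2 j, j != i & w = m j /\ forall z, z \in x |: t -> r j w <= r j z.
  move=> wt; have [j Hj] := xD w; exists j.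
    apply/eqP => ji; have := Hj x; rewrite !inE eqxx => /(_ isT).
    by rewrite ji leqNgt lti.
  by split=> //; apply: mE => // z zt; apply: Hj; rewrite !inE zt orbT.
have minj : {in [set~ i] &, injective m}.
  apply/imset_injP; rewrite cardsC1 -tI /=.
  rewrite (_ : m @: _ = t)//; apply/setP => w; apply/imsetP/idP.
    by case=> j _ ->.
  by case/mi => j ji [-> _]; exists j => //; rewrite !inE.
have iab : (i == a) || (i == b).
  apply/norP => -[ia ib]; move/eqP: ab; apply; apply: minj => //.
    by rewrite !inE eq_sym.
  by rewrite !inE eq_sym.
have xM : x \in above t i.
  apply/aboveP => j ji; exists (m j) => //.
  have [j' j'i [mjj' H]] := mi _ (mt j).
  have jj' : j = j' by apply: minj; rewrite ?inE.
  have := H x (setU11 _ _); rewrite -jj' leq_eqVlt => /predU1P[/r_inj mx|//].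
  by move: xt; rewrite -mx mt.
have xg : x = g i.
  apply: (r_inj (i := i)); apply/eqP; rewrite eqn_leq (gP i).2//=.
  have [j Hj] := xD (g i); have [ji|ji] := eqVneq j i.
    by move: Hj; rewrite ji; apply; exact: setU11.
  have /aboveP/(_ _ ji)[w wt] := (gP i).1.
  by rewrite ltnNge Hj// !inE wt orbT.
by rewrite xg; case/orP: iab => /eqP ->; rewrite eqxx ?orbT.
Qed.

End dominant_sets.

(** * Sperner's parity argument *)

Section parity.
Context (V I : finType) (r : I -> V -> nat) (c : V -> I) (o : I).
Implicit Types (s t : {set V}).

(** Facets of Sperner's parity argument, where [o] is the color left out. *)
Definition door t :=
  [&& dominant r t, c @: t == [set~ o] & #|t|.+1 == #|I|].

(** Unless all the colors occur in [s], the existence of one door forces a color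
    to be borne by two elements of [s], and then the doors are obtained by
    dropping either of these two. *)
Lemma even_card_doors s : #|s| = #|I| -> c @: s != setT ->
  ~~ odd #|[set x in s | c @: (s :\ x) == [set~ o]]|.
Proof.
move=> sI snT; set X := [set x in s | _].
have [-> |[x]] := set_0Vmem X; first by rewrite cards0.
rewrite inE => /andP[xs /eqP cx].
have cinj : {in s :\ x &, injective c}.
  apply/imset_injP; rewrite cx cardsC1 -sI.
  by rewrite (cardsD1 x s) xs.
have cxo : c x != o.
  apply: contra snT => /eqP cxo; rewrite -(setD1K xs) imsetU1 cx cxo.
  by apply/eqP/setP => i; rewrite !inE; case: eqP.
have /imsetP[x' x's cxx'] : c x \in c @: (s :\ x) by rewrite cx !inE.
have [x'x x'inS] : x' != x /\ x' \in s by move: x's; rewrite !inE => /andP.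
suff -> : X = [set x; x'] by rewrite cards2 eq_sym x'x.
apply/setP => z; rewrite !inE; apply/andP/idP => [[zs /eqP cz]|].
  have : c z != o.
    have [-> //|zx] := eqVneq z x.
    have : c z \in c @: (s :\ x) by apply: imset_f; rewrite !inE zx.
    by rewrite cx !inE.
  have [zx|zx] := eqVneq z x; first by [].
  rewrite /= => czo.
  have /imsetP[w] : c z \in c @: (s :\ z) by rewrite cz !inE.
  rewrite !inE => /andP[wz ws] czw.
  have [wx|wx] := eqVneq w x.
    by apply/eqP; apply: cinj; rewrite ?inE ?zx ?zs ?x'x// czw wx.
  by move: wz; rewrite (cinj z w) ?eqxx// !inE ?zx ?wx.
case/orP => /eqP ->; first by rewrite xs cx.
rewrite x'inS; split=> //; apply/eqP; rewrite -cx.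
have -> : s :\ x' = x |: (s :\ x :\ x').
  apply/setP => y; rewrite !inE; case: (eqVneq y x) => [->|_] /=.
    by rewrite xs eq_sym x'x.
  by [].
have -> : s :\ x = x' |: (s :\ x :\ x') by rewrite setD1K.
rewrite !imsetU1 cxx'; congr (_ |: _ @: _).
by rewrite setU1K // !inE eqxx.
Qed.

(** Double counting of the incidences between doors and top cells. *)
Lemma exists_colorful : odd (\sum_(t | door t) #|cofacets r t|) ->
  exists s, [/\ dominant r s, #|s| = #|I| & c @: s = setT].
Proof.
move=> H.
have [/existsP[s /and3P[sD /eqP sI /eqP cs]]|/existsPn none] :=
  boolP [exists s, [&& dominant r s, #|s| == #|I| & c @: s == setT]].
  by exists s.
suff E : \sum_(t | door t) #|cofacets r t| =
    \sum_(s | dominant r s && (#|s| == #|I|))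
      #|[set x in s | c @: (s :\ x) == [set~ o]]|.
  exfalso; move: H; rewrite E; apply/negP.
  apply: (big_ind (fun n => ~~ odd n)) => // [m n|s].
    by rewrite oddD => /negPf -> /negPf ->.
  move=> /andP[sD /eqP sI]; apply: even_card_doors => //.
  by have := none s; rewrite sD sI eqxx.
under eq_bigr do rewrite -sum1_card.
under [RHS]eq_bigr do rewrite -sum1_card.
rewrite (exchange_big_dep predT)//= [RHS](exchange_big_dep predT)//=.
apply: eq_bigr => x _.
rewrite (reindex_onto (fun s => s :\ x) (fun t => x |: t)) /=; last first.
  by move=> t /andP[_]; rewrite inE => /andP[xt _]; rewrite setU1K.
apply: eq_bigl => s; rewrite /door !inE.
have [xs|xs] := boolP (x \in s); last first.
  rewrite [RHS]andbF; apply/negbTE/negP => /andP[_ /eqP E].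
  by move: xs; rewrite -E setU11.
rewrite setD1K// !eqxx /= andbT (cardsD1 x s) xs add1n.
have [sD|] := boolP (dominant r s); last by rewrite !andbF.
by rewrite (dominantS (subD1set _ _) sD) /= andbT andbC.
Qed.
End parity.

(** * Scarf's lemma *)

Section scarf.
Context (T I : finType) (rho : I -> T -> nat) (c : T -> I).
Hypothesis rho_inj : forall i, injective (rho i).

Let B := (\max_(ix : I * T) rho ix.1 ix.2).+2.

(** Each color [i] receives an ideal point, ranked last by [i] and ahead of all
    the ordinary points by the other colors. A dominant set that contains the
    ideal points of the colors outside of [C] is dominant through the orders in
    [C] alone, so that Scarf's pairs of a set of points and a set of colors
    become plain sets, all of the same size. *)
Definition corner_rank (j : I) (v : T + I) : nat :=
  match v with
  | inl x => (rho j x).+1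
  | inr i => if i == j then 0 else B + enum_rank i
  end.

Definition corner_color (v : T + I) : I :=
  match v with inl x => c x | inr i => i end.

Let rho_lt j x : (rho j x).+1 < B.
Proof. by rewrite !ltnS (leq_bigmax (j, x)). Qed.

Lemma corner_rank_inj j : injective (corner_rank j).
Proof.
move=> [x|i] [y|i'] /=.
- by case=> /rho_inj ->.
- by case: eqP => // _ E; have := rho_lt j x; rewrite E ltnNge leq_addr.
- by case: eqP => // _ E; have := rho_lt j y; rewrite -E ltnNge leq_addr.
- case: eqP => [->|_]; case: eqP => [->|_]//.
  by move=> /addnI /val_inj /enum_rank_inj ->.
Qed.

Local Notation dom := (dominant corner_rank).
Local Notation cofac := (cofacets corner_rank).

(** This face lies on the boundary: the only point that completes it is the
    greatest ordinary one in the order of the missing color. *)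
Lemma card_cofacets_corner o (t0 : T) :
  #|cofac [set inr i | i in [set~ o]]| = 1.
Proof.
set E := [set inr i | i in _].
pose x := [arg max_(y > t0) rho o y].
have xmax y : rho o y <= rho o x.
  by rewrite /x; case: arg_maxnP => // z _ zle; exact: zle.
suff -> : cofac E = [set inl x] by rewrite cards1.
apply/setP => v; rewrite !inE; apply/andP/eqP => [[vE /dominantP vD]|->].
  move: vE vD; case: v => [y|i] vE vD.
    have [i Hi] := vD (inl x).
    have io : i = o.
      apply/eqP/negPn/negP => io; have := Hi (inr i).
      rewrite /= eqxx ltn0 => H.
      by suff: false by []; apply: H; rewrite !inE imset_f ?inE.
    have /(_ (setU11 _ _)) := Hi (inl y); rewrite /= io ltnS => xy.
    by congr inl; apply: (@rho_inj o); apply/eqP; rewrite eqn_leq xy xmax.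
  have io : i = o.
    by apply/eqP/negPn; move: vE; apply: contra => io; rewrite imset_f ?inE.
  have [j Hj] := vD (inl x); have := Hj (inr j); rewrite /= eqxx ltn0 => H.
  suff : false by []; apply: H; rewrite !inE; have [->|ji] := eqVneq j i; first by rewrite eqxx.
  by rewrite imset_f ?orbT// !inE -io.
split; first by apply/imsetP => -[].
apply/dominantP => -[y|i].
  exists o => z; rewrite !inE => /predU1P[->|]; first by rewrite /= ltnS.
  case/imsetP => i; rewrite !inE => io -> /=; rewrite (negPf io).
  by apply: ltnW; apply: leq_trans (rho_lt o y) _; rewrite leq_addr.
by exists i => z _ /=; rewrite eqxx.
Qed.

(** A door without ordinary points must be the boundary face of [o]. Any other
    door [t] has an ordinary point, over which the ideal point of [i] ranks in
    all the orders but [i]: no [above t i] is empty. *)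
Lemma odd_sum_cofacets o (t0 : T) :
  odd (\sum_(t | door corner_rank corner_color o t) #|cofac t|).
Proof.
set E := [set inr i | i in [set~ o]] : {set T + I}.
have Einj : injective (@inr T I) by move=> i j [].
have Ed : door corner_rank corner_color o E.
  apply/and3P; split.
  - apply/dominantP => -[y|i].
      exists o => _ /imsetP[i io ->]; move: io; rewrite !inE => io /=; rewrite (negPf io).
      by apply: ltnW; apply: leq_trans (rho_lt o y) _; rewrite leq_addr.
    by exists i => z _ /=; rewrite eqxx.
  - by rewrite /E -imset_comp (eq_imset (g := id)) ?imset_id.
  - by rewrite card_imset// cardsC1 prednK //; apply/card_gt0P; exists o.
rewrite (bigD1 E)//= card_cofacets_corner// add1n /=.
apply: (big_ind (fun n => ~~ odd n)) => // [m n|t].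
  by rewrite oddD => /negPf -> /negPf ->.
move=> /andP[/and3P[tD /eqP tc /eqP tI] tE].
have [/existsP[x xt]|/existsPn noT] := boolP [exists x : T, inl x \in t]; last first.
  exfalso; move/eqP: tE; apply; apply/eqP; rewrite eqEcard; apply/andP; split.
    apply/subsetP => -[x|i] vt; first by have /negP := noT x.
    by rewrite imset_f// -tc -[i]/(corner_color (inr i)) imset_f.
  by rewrite card_imset// cardsC1 -tI.
rewrite (card_cofacets corner_rank_inj)//.
  by apply/set0Pn; exists (inl x).
move=> i; apply/set0Pn; exists (inr i); apply/aboveP => j ji.
exists (inl x) => //=; rewrite eq_sym (negPf ji).
by apply: leq_trans (rho_lt j x) _; rewrite leq_addr.
Qed.

(** Take a colorful cell of the complex with ideal points. The colors [C] are those
    whose ideal point is missing from it: as every color occurs once, they are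
    borne by ordinary points. An ideal point is last in its own order, so that
    dominance is decided by the orders in [C]. *)
Theorem scarf (o : I) (t0 : T) :
  exists (C : {set I}) (z : I -> T),
    [/\ C != set0, forall i, i \in C -> c (z i) = i &
        forall y, exists2 i, i \in C &
          forall j, j \in C -> rho i y <= rho i (z j)].
Proof.
have [s [/dominantP sD sI sc]] := exists_colorful (odd_sum_cofacets o t0).
pose C := [set i | inr i \notin s].
have Hz i : exists x, i \in C -> inl x \in s /\ c x = i.
  have [iC|iC] := boolP (i \in C); last by exists t0.
  have /imsetP[[x|j] vs /= iE] : i \in corner_color @: s by rewrite sc inE.
    by exists x.
  by move: iC; rewrite inE iE vs.
have [z zP] := fin_all_exists Hz.
have CD y : exists2 i, i \in C & forall j, j \in C -> rho i y <= rho i (z j).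
  have [i Hi] := sD (inl y); exists i.
    by rewrite inE; apply/negP => /Hi /=; rewrite eqxx.
  by move=> j /zP[/Hi].
exists C, z; split=> // [|i /zP[]//].
by have [i iC _] := CD t0; apply/set0Pn; exists i.
Qed.
End scarf.

(** * Scarf's lemma on the grid points of a simplex *)

(** The grid approximation of the simplex consists of the points whose coordinates
    are natural numbers of sum [n], each color ranking them by its coordinate. If
    the minima over the dominant set of the coordinates in [C], each increased by
    one, had a sum of at most [n], some grid point would beat them all. The
    coordinates in [C] therefore add up to almost [n] already at their minima,
    which leaves less than [m] for any deviation. *)
Lemma scarf_grid (m n : nat) (c : {ffun 'I_m -> 'I_n.+1} -> 'I_m) (o : 'I_m) :
  exists (C : {set 'I_m}) (z : 'I_m -> {ffun 'I_m -> 'I_n.+1}),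
    [/\ C != set0, forall i, i \in C -> c (z i) = i,
        forall i, \sum_l z i l = n,
        forall i j l, i \in C -> j \in C -> z i l < z j l + m &
        forall i l, i \in C -> l \notin C -> z i l < m].
Proof.
pose T := {f : {ffun 'I_m -> 'I_n.+1} | \sum_l f l == n}.
(* Equal coordinates are ordered by the enumeration of [T]. *)
pose rho (i : 'I_m) (f : T) : nat := val f i * #|{: T}| + enum_rank f.
have divT (f : T) : (enum_rank f %/ #|{: T}|) = 0 by apply: divn_small.
have T0 (f : T) : 0 < #|{: T}| by apply/card_gt0P; exists f.
have rho_inj i : injective (rho i).
  move=> f g /(congr1 (modn^~ #|{: T}|)).
  by rewrite !modnMDl !modn_small// => /val_inj/enum_rank_inj.
have rho_le i f g : rho i f <= rho i g -> val f i <= val g i.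
  move=> /(leq_div2r #|{: T}|).
  by rewrite !divnMDl ?(T0 f)// !divT !addn0.
have mkT (a : 'I_m -> nat) : \sum_l a l = n -> exists f : T, forall l, val f l = a l :> nat.
  move=> an; have al l : a l < n.+1 by rewrite ltnS -an (bigD1 l)//= leq_addr.
  pose f := [ffun l => Ordinal (al l)].
  have fn : \sum_l f l == n by apply/eqP; rewrite -[RHS]an; apply: eq_bigr => l _; rewrite ffunE.
  by exists (exist _ f fn) => l /=; rewrite ffunE.
have [t0 _] := mkT (fun l => if l == o then n else 0)
  (etrans (esym (big_mkcond _ _)) (big_pred1_eq _ _ _)).
have [C [z [C0 cz zD]]] := scarf (fun f : T => c (val f)) rho_inj o t0.
exists C, (fun i => val (z i)).
have zn i : \sum_l val (z i) l = n by apply/eqP; exact: valP (z i).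
have /set0Pn[i0 i0C] := C0.
pose mu l := val (z [arg min_(j < i0 in C) val (z j) l]) l : nat.
have mu_le l j : j \in C -> mu l <= val (z j) l.
  by move=> jC; rewrite /mu; case: arg_minnP => // i iC; exact.
have mu_ex l : exists2 j, j \in C & mu l = val (z j) l.
  by rewrite /mu; case: arg_minnP => // i iC _; exists i.
have sum_mu : n < \sum_(l in C) (mu l).+1.
  rewrite ltnNge; apply/negP => sle.
  (* The weight left over is put on one coordinate in [C]. *)
  pose a l := (if l \in C then (mu l).+1 else 0) +
    (if l == i0 then n - \sum_(l in C) (mu l).+1 else 0).
  have /mkT[f fE] : \sum_l a l = n.
    by rewrite big_split /= -!big_mkcond /= big_pred1_eq subnKC.
  have [i iC Hi] := zD f; have [j jC muE] := mu_ex i.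
  have := rho_le _ _ _ (Hi j jC).
  by rewrite -muE fE /a iC addSn ltnNge leq_addr.
have sumC i : i \in C -> \sum_(l in C) val (z i) l < \sum_(l in C) mu l + m.
  move=> iC; have /eqP := zn i; rewrite eqn_leq => /andP[H _].
  have Hn : \sum_(l in C) val (z i) l <= n.
    by apply: leq_trans H; rewrite [leqRHS](bigID (mem C))/= leq_addr.
  apply: leq_ltn_trans Hn _.
  apply: leq_trans sum_mu _; under eq_bigr do rewrite -addn1.
  by rewrite big_split /= sum1_card leq_add2l -[leqRHS]card_ord max_card.
have small i l : i \in C -> l \notin C -> val (z i) l < m.
  move=> iC lC; 
  have H1 : \sum_(l' in C) val (z i) l' + val (z i) l <= n.
    have /eqP := zn i; rewrite eqn_leq => /andP[H _]; apply: leq_trans H.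
    by rewrite [leqRHS](bigID (mem C))/= leq_add2l (bigD1 l)//= leq_addr.
  have : \sum_(l' in C) mu l' <= \sum_(l' in C) val (z i) l'.
    by apply: leq_sum => l' l'C; exact: mu_le.
  have : \sum_(l in C) (mu l).+1 <= \sum_(l in C) mu l + m.
    under eq_bigr do rewrite -addn1.
    by rewrite big_split /= sum1_card leq_add2l -[leqRHS]card_ord max_card.
  by move: sum_mu; lia.
split=> // i j l iC jC.
have [lC|lC] := boolP (l \in C); last exact: ltn_addl (small i l iC lC).
have D1 (f : 'I_m -> nat) :
    \sum_(l' in C) f l' = f l + \sum_(l' in C | l' != l) f l' by exact: bigD1.
have := sumC i iC; have := mu_le l j jC; rewrite !D1.
have : \sum_(l' in C | l' != l) mu l' <= \sum_(l' in C | l' != l) val (z i) l'.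
  by apply: leq_sum => l' /andP[l'C _]; exact: mu_le.
set a := \sum_(_ in _ | _) _; set b := \sum_(_ in _ | _) _.
move: (mu l) (nat_of_ord (\val (z i) l)) (nat_of_ord (\val (z j) l)); clearbody a b; lia.
Qed.

From mathcomp Require Import all_classical all_reals all_analysis.
From mathcomp Require Import measurable_realfun ring lra.

Import Order.TTheory GRing.Theory Num.Theory.
Import numFieldNormedType.Exports.

Local Open Scope classical_set_scope.
Local Open Scope ring_scope.

(** * The Knaster-Kuratowski-Mazurkiewicz theorem *)

Lemma ler_mxnorm (R : realType) (m : nat) (x : 'rV[R]_m) i : `|x ord0 i| <= `|x|.
Proof.
rewrite -[leRHS]/(mx_norm x) mx_normrE.
by rewrite (le_bigmax (0 : R) (fun ij => `|x ij.1 ij.2|) (ord0, i)).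
Qed.

Lemma mxnorm_le (R : realType) (m : nat) (x : 'rV[R]_m) (M : R) : 0 <= M ->
  (forall i, `|x ord0 i| <= M) -> `|x| <= M.
Proof.
move=> M0 xM; rewrite -[leLHS]/(mx_norm x) mx_normrE.
by apply: bigmax_le => // -[i j] _ /=; rewrite ord1.
Qed.

Lemma cvg_sum_real (R : realType) (T : Type) (F : set_system T) (FF : Filter F)
    (I : finType) (f : I -> T -> R) (a : I -> R) :
  (forall i, f i x @[x --> F] --> a i) ->
  \sum_i f i x @[x --> F] --> \sum_i a i.
Proof. by move=> fa; apply: cvg_big => //; exact: add_continuous. Qed.

Lemma continuous_of_lipschitz1 (R : realType) (V : normedModType R) (f : V -> R) :
  (forall x y, f x <= f y + `|x - y|) -> continuous f.
Proof.
move=> fl y; apply/cvgrPdist_le => e e0; near=> z.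
have zy : `|y - z| <= e.
  by near: z; apply/nbhs_ballP; exists e => //= z; rewrite -ball_normE => /ltW.
rewrite ler_norml; apply/andP; split.
  by rewrite lerNl opprB lerBlDl (le_trans (fl z y))// distrC lerD2l.
by rewrite lerBlDl (le_trans (fl y z))// lerD2l.
Unshelve. all: by end_near. Qed.

Section distance.
Context (R : realType) (V : normedModType R) (F : set V).
Hypothesis F0 : F !=set0.

Definition dist_to (x : V) : R := inf [set `|x - y| | y in F].

Let has_inf_dist x : has_inf [set `|x - y| | y in F].
Proof.
split; first by have [y Fy] := F0; exists `|x - y|; exists y.
by exists 0 => _ [y _ <-].
Qed.

Lemma dist_to_ge0 x : 0 <= dist_to x.
Proof. by apply: lb_le_inf; [case: (has_inf_dist x)|move=> _ [y _ <-]]. Qed.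

Lemma dist_to_le x y : F y -> dist_to x <= `|x - y|.
Proof. by move=> Fy; apply: ge_inf; [case: (has_inf_dist x)|exists y]. Qed.

Lemma dist_to_lipschitz x y : dist_to x <= dist_to y + `|x - y|.
Proof.
rewrite -lerBlDr; apply: lb_le_inf; first by case: (has_inf_dist y).
move=> _ [z Fz <-]; rewrite lerBlDr (le_trans (dist_to_le x Fz))//.
by rewrite [leRHS]addrC -[x - z](subrKA y) ler_normD.
Qed.

Lemma dist_to_in x : F x -> dist_to x = 0.
Proof.
move=> Fx; apply/eqP; rewrite eq_le dist_to_ge0 andbT.
by rewrite (le_trans (dist_to_le x Fx))// subrr normr0.
Qed.

Lemma dist_to_eq0 x : closed F -> dist_to x = 0 -> F x.
Proof.
move=> Fcl d0; apply: Fcl => U /nbhs_ballP[e /= e0 eU].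
have [_ [y Fy <-]] : exists2 d, [set `|x - y| | y in F] d & d < e.
  by apply: inf_lt; [by case: (has_inf_dist x)|rewrite -/(dist_to x) d0].
by move=> xye; exists y; split => //; apply: eU; rewrite -ball_normE.
Qed.

End distance.

Section KKM.
Context (R : realType) (m : nat).

Definition simplex : set 'rV[R]_m :=
  [set x | (forall i, 0 <= x ord0 i) /\ \sum_i x ord0 i = 1].

Lemma simplex_le1 x i : simplex x -> x ord0 i <= 1.
Proof.
by move=> [x0 <-]; rewrite (bigD1 i)//= lerDl; apply: sumr_ge0 => j _; exact: x0.
Qed.

Lemma simplex_norm x : simplex x -> `|x| <= 1.
Proof.
move=> xS; apply: mxnorm_le => // i; rewrite ger0_norm ?simplex_le1//.
by case: xS.
Qed.

Lemma simplex_compact : compact simplex.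
Proof.
apply: bounded_closed_compact.
  exists 1; split=> // M M1 x /simplex_norm x1.
  exact: le_trans x1 (ltW M1).
rewrite (_ : simplex = (\bigcap_i [set x : 'rV[R]_m | 0 <= x ord0 i]) `&`
    [set x | \sum_i x ord0 i = 1]); last first.
  apply/seteqP; split=> [x [x0 x1]|x [x0 x1]].
    by split=> // i _; exact: x0.
  by split=> // i; exact: x0.
apply: closedI.
  apply: closed_bigI => i _.
  apply: (@closed_comp _ _ (fun x : 'rV[R]_m => x ord0 i) [set r | 0 <= r]).
    by move=> x _; exact: coord_continuous.
  exact: closed_ge.
apply: (@closed_comp _ _ (fun x : 'rV[R]_m => \sum_i x ord0 i) [set r | r = 1]).
  move=> x _; apply: (@cvg_sum_real _ _ (nbhs x) _) => i.
  exact: coord_continuous.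
exact: closed_eq.
Qed.

Variable d : 'I_m -> 'rV[R]_m -> R.
Hypothesis d_ge0 : forall i x, 0 <= d i x.
Hypothesis d_lip : forall i x y, d i x <= d i y + `|x - y|.

Let D x := \sum_i d i x.

Let D_lip x y : D x <= D y + m%:R * `|x - y|.
Proof.
rewrite /D; apply: (@le_trans _ _ (\sum_i (d i y + `|x - y|))).
  by apply: ler_sum => i _; exact: d_lip.
by rewrite big_split/= sumr_const card_ord mulr_natl.
Qed.

(** At each point of the simplex the numbers [x_i * D x] and [d i x] have the same
    sum over [i], so some [i] satisfies the inequality exactly: take it as the
    color of [x]. Scarf's lemma gives points close to each other whose colors
    form a set [C], while the coordinates outside of [C] almost vanish. By
    continuity any one of these points almost satisfies all the inequalities. *)
Lemma approximate_share (e : R) : (0 < m)%N -> 0 < e ->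
  exists2 x, simplex x & forall i, x ord0 i * D x <= d i x + e.
Proof.
move=> m0 e0.
pose M := D 0 + m%:R.
have D0 x : 0 <= D x by apply: sumr_ge0.
have DM x : simplex x -> D x <= M.
  move=> /simplex_norm x1; rewrite (le_trans (D_lip x 0))// lerD2l subr0.
  by rewrite ler_piMr.
have M0 : 0 <= M by rewrite addr_ge0.
(* [L] times the mesh [del] bounds the total error made in replacing one
   point of the dominant set by another. *)
pose L := 1 + M + m%:R.
have L0 : 0 < L by rewrite /L -addrA ltr_wpDr// addr_ge0.
pose n := (Num.truncn (m%:R * L / e)).+1.
have nn0 : n%:R != 0 :> R by rewrite pnatr_eq0.
pose del : R := m%:R / n%:R.
have del0 : 0 <= del by rewrite divr_ge0.
have delL : del * L <= e.
  rewrite /del mulrAC ler_pdivrMr ?ltr0n// -ler_pdivrMl// mulrC.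
  by rewrite ltW// truncnS_gt.
pose P (f : {ffun 'I_m -> 'I_n.+1}) : 'rV[R]_m := \row_i ((f i : nat)%:R / n%:R).
pose o := Ordinal m0.
pose c f := odflt o [pick i | P f ord0 i * D (P f) <= d i (P f)].
have PS (f : {ffun 'I_m -> 'I_n.+1}) : (\sum_l f l)%N = n -> simplex (P f).
  move=> fn; split=> [i|]; first by rewrite mxE divr_ge0.
  under eq_bigr do rewrite mxE.
  by rewrite -mulr_suml -natr_sum fn divff.
have cP (f : {ffun 'I_m -> 'I_n.+1}) : (\sum_l f l)%N = n ->
    P f ord0 (c f) * D (P f) <= d (c f) (P f).
  move=> /PS[_ P1]; rewrite /c; case: pickP => //= H; exfalso.
  suff : D (P f) < D (P f) by rewrite ltxx.
  rewrite -[ltRHS]mul1r -P1 mulr_suml /D; apply: ltr_sum.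
    by apply/hasP; exists o; rewrite ?mem_index_enum.
  by move=> i _; rewrite ltNge H.
have [C [z [C0 cz zn zclose zout]]] := scarf_grid c o.
have /set0Pn[i0 i0C] := C0.
exists (P (z i0)) => [|l]; first exact: PS.
set x := P (z i0).
have xS : simplex x by exact: PS.
have [lC|lC] := boolP (l \in C); last first.
  have xl : x ord0 l <= del.
    by rewrite mxE ler_pM2r ?invr_gt0 ?ltr0n// ler_nat ltnW// zout.
  have x0 : 0 <= x ord0 l by case: xS.
  have : x ord0 l * D x <= del * M by rewrite ler_pM// DM.
  have := d_ge0 l x; have : 0 <= del * m%:R by rewrite mulr_ge0.
  by move: delL; rewrite /L !mulrDr; lra.
have yS : simplex (P (z l)) by exact: PS.
have := cP _ (zn l); rewrite cz//.
set y := P (z l) in yS *.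
have close (i j l' : 'I_m) : i \in C -> j \in C ->
    P (z i) ord0 l' - P (z j) ord0 l' <= del.
  move=> iC jC; rewrite !mxE -mulrBl ler_pM2r ?invr_gt0 ?ltr0n//.
  by rewrite lerBlDl -natrD ler_nat ltnW// zclose.
have xy : `|x - y| <= del.
  apply: mxnorm_le => // i; rewrite [(x - y) _ _]mxE [(- y) _ _]mxE.
  by rewrite ler_norml close// andbT lerNl opprB close.
have xyl : x ord0 l <= y ord0 l + del by rewrite -lerBlDl close.
have x01 : 0 <= x ord0 l <= 1 by rewrite (simplex_le1 _ xS) andbT; case: xS.
have y0 : 0 <= y ord0 l by case: yS.
have Dxy : D x <= D y + m%:R * del.
  by rewrite (le_trans (D_lip x y))// lerD2l ler_wpM2l.
have dyx : d l y <= d l x + del.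
  by rewrite (le_trans (d_lip l y x))// lerD2l distrC.
have DyM := DM _ yS; have Dy0 := D0 y; have Dx0 := D0 x.
move=> yD; case/andP: x01 => x0 x1.
have h1 : x ord0 l * D x <= x ord0 l * D y + m%:R * del.
  have : x ord0 l * D x <= x ord0 l * (D y + m%:R * del) by exact: ler_wpM2l.
  have : x ord0 l * (m%:R * del) <= m%:R * del by rewrite ler_piMl ?mulr_ge0.
  by rewrite mulrDr; lra.
have h2 : x ord0 l * D y <= y ord0 l * D y + del * M.
  rewrite (le_trans (ler_wpM2r Dy0 xyl))// mulrDl lerD2l.
  exact: ler_wpM2l.
by move: delL; rewrite /L (mulrDr _ (1 + M)) (mulrDr _ 1) mulr1; lra.
Qed.

End KKM.

(** Let [d_i] be the distance to [F i] and [D] the sum of these distances. By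
    compactness some [x] in the simplex satisfies [x_i * D <= d_i] for all [i].
    The covering hypothesis yields [i] with [x_i > 0] and [d_i = 0], hence [D = 0]
    and [x] belongs to all the closed sets [F i]. *)
Theorem KKM (R : realType) (m : nat) (F : 'I_m -> set 'rV[R]_m) :
  (0 < m)%N -> (forall i, closed (F i)) ->
  (forall x, simplex x -> exists2 i, 0 < x ord0 i & F i x) ->
  exists2 x, simplex x & forall i, F i x.
Proof.
move=> m0 Fcl Fcov.
have F0 i : F i !=set0.
  exists (delta_mx ord0 i).
  have [|j] := Fcov (delta_mx ord0 i).
    split=> [j|]; first by rewrite mxE eqxx /=; case: eqP.
    rewrite (bigD1 i)//= big1 ?addr0 ?mxE ?eqxx// => j ji.
    by rewrite mxE eqxx (negPf ji).
  by rewrite mxE eqxx /=; case: eqP => [->|]; rewrite ?ltxx.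
pose d i := dist_to (F i).
have d0 i x : 0 <= d i x by exact: dist_to_ge0.
have dl i x y : d i x <= d i y + `|x - y| by exact: dist_to_lipschitz.
have /choice[u uP] (n : nat) : exists x, simplex x /\
    forall i, x ord0 i * (\sum_j d j x) <= d i x + n.+1%:R^-1.
  have [|x xS xP] := approximate_share d0 dl m0 (_ : 0 < n.+1%:R^-1 :> R).
    by rewrite invr_gt0.
  by exists x.
have [x [xS xcl]] : @simplex R m `&` cluster (u @ \oo) !=set0.
  apply: (@simplex_compact R m (u @ \oo) _); by exists 0%N => // n _; have [] := uP n.
have dcont i : continuous (d i) by exact: continuous_of_lipschitz1 (dl i).
have xP i : x ord0 i * (\sum_j d j x) <= d i x.
  apply/ler_addgt0Pr => e e0.
  pose g (y : 'rV[R]_m) := y ord0 i * (\sum_j d j y) - d i y.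
  rewrite -lerBlDl -[leLHS]/(g x).
  have gcl : closed [set y | g y <= e].
    apply: (@closed_comp _ _ g [set r | r <= e]); last exact: closed_le.
    move=> y _; apply: (@cvgB _ R^o _ (nbhs y)); last exact: dcont.
    apply: (@cvgM _ _ (nbhs y)); first exact: coord_continuous.
    by apply: (@cvg_sum_real _ _ (nbhs y)) => j; exact: dcont.
  apply: gcl; move: xcl; rewrite clusterE; apply; rewrite /fmap /=; near=> n.
  rewrite /= /g lerBlDl (le_trans ((uP n).2 i))// lerD2l.
  by apply: ltW; near: n; exact: (near_infty_natSinv_lt (PosNum e0)).
have D0 : \sum_j d j x = 0.
  have [i xi /dist_to_in] := Fcov x xS.
  move=> /(_ (F0 i)) dix; have := xP i; rewrite [leRHS]dix pmulr_rle0//.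
  by move=> H; apply/eqP; rewrite eq_le H sumr_ge0.
exists x => // i; apply: (dist_to_eq0 (F0 i) (Fcl i)).
by apply/eqP; have /eqP := D0; rewrite psumr_eq0// => /allP/(_ i (mem_index_enum _)).
Unshelve. all: by end_near. Qed.

(** * Sublinear functionals *)

Section mazur_orlicz.
Context (R : realType) (V : lmodType R).
Implicit Types (p q f : V -> R) (G : set (V * R)).

Definition sublinear p :=
  (forall x y, p (x + y) <= p x + p y) /\
  (forall (t : R) x, 0 < t -> p (t *: x) <= t * p x).

Lemma sublinear0 p : sublinear p -> p 0 = 0.
Proof.
move=> [pD pZ]; have := pD 0 0; have := pZ 2^-1 0.
rewrite addr0 scaler0 invr_gt0 ltr0n => /(_ isT); lra.
Qed.

Lemma sublinearN p x : sublinear p -> - p (- x) <= p x.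
Proof.
move=> pS; have := pS.1 x (- x).
by rewrite subrr (sublinear0 pS); lra.
Qed.

(** A pair [(g, s)] stands for the constraint [s <= f g] on a linear form [f]. *)
Definition cone G := [/\ G (0, 0), forall a b, G a -> G b -> G (a + b) &
  forall t a, 0 < t -> G a -> G (t *: a.1, t * a.2)].

(** The infimum of [p (x + g) - s] over the constraints [(g, s)] is sublinear; it is
    finite since [s <= p g] bounds these numbers below by [- p (- x)]. *)
Lemma sublinear_reduce p G : sublinear p -> cone G ->
  (forall a, G a -> a.2 <= p a.1) ->
  exists q, [/\ sublinear q, forall x, q x <= p x &
    forall a, G a -> q (- a.1) <= - a.2].
Proof.
move=> pS [G0 GD GZ] Gp.
pose S x := [set p (x + a.1) - a.2 | a in G].
have Sinf x : has_inf (S x).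
  split; first by exists (p (x + 0) - 0), (0, 0).
  exists (- p (- x)) => _ [a Ga <-].
  have := pS.1 (x + a.1) (- x); rewrite addrAC subrr add0r.
  by have := Gp _ Ga; lra.
pose q x := inf (S x).
have qle x a : G a -> q x <= p (x + a.1) - a.2.
  by move=> Ga; apply: ge_inf; [case: (Sinf x)|exists a].
exists q; split.
- split=> [x y|t x t0].
    rewrite -lerBlDr; apply: lb_le_inf; first by case: (Sinf x).
    move=> _ [a Ga <-]; rewrite lerBlDr -lerBlDl.
    apply: lb_le_inf; first by case: (Sinf y).
    move=> _ [b Gb <-]; have := qle (x + y) _ (GD _ _ Ga Gb).
    have := pS.1 (x + a.1) (y + b.1); rewrite /= addrACA; lra.
  rewrite -ler_pdivrMl//; apply: lb_le_inf; first by case: (Sinf x).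
  move=> _ [a Ga <-]; rewrite ler_pdivrMl//.
  have := qle (t *: x) _ (GZ _ _ t0 Ga).
  have := pS.2 t (x + a.1) t0; rewrite /= scalerDr mulrBr; lra.
- by move=> x; have := qle x _ G0; rewrite /= addr0 subr0.
- move=> a Ga; have := qle (- a.1) _ Ga.
  by rewrite addNr (sublinear0 pS) add0r.
Qed.

Let below p := {q : V -> R | sublinear q /\ forall x, q x <= p x}.

(** Zorn's lemma: the infimum of a chain of sublinear functionals below [p] is
    sublinear, and bounded below by [- p (- x)]. *)
Lemma sublinear_minimal p : sublinear p ->
  exists2 m, sublinear m /\ (forall x, m x <= p x) &
    forall q, sublinear q -> (forall x, q x <= m x) -> q = m.
Proof.
move=> pS; pose r (a b : below p) := `[< forall x, sval b x <= sval a x >].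
have [||||m mmin] := @Zorn (below p) r.
- by move=> a; apply/asboolP.
- move=> a b c /asboolP ab /asboolP bc; apply/asboolP => x.
  exact: le_trans (bc x) (ab x).
- move=> [a Pa] [b Pb] /asboolP /= ab /asboolP /= ba.
  have E : a = b by apply/funext => x; apply/le_anti; rewrite ab ba.
  by rewrite E in Pa *; congr exist; exact: Prop_irrelevance.
- move=> A Atot; have [->|/set0P[a0 Aa0]] := eqVneq A set0.
    by exists (exist _ p (conj pS (fun x => lexx _))).
  pose S x := [set sval a x | a in A].
  have Sinf x : has_inf (S x).
    split; first by exists (sval a0 x), a0.
    exists (- p (- x)) => _ [[a [/= aS ap]] _ <-] /=.
    by have := sublinearN x aS; have := ap (- x); lra.
  pose q x := inf (S x).
  have qle x a : A a -> q x <= sval a x.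
    by move=> Aa; apply: ge_inf; [case: (Sinf x)|exists a].
  have qS : sublinear q.
    split=> [x y|t x t0].
      rewrite -lerBlDr; apply: lb_le_inf; first by case: (Sinf x).
      move=> _ [a Aa <-]; rewrite lerBlDr -lerBlDl.
      apply: lb_le_inf; first by case: (Sinf y).
      move=> _ [b Ab <-]; rewrite lerBlDl.
      case: (Atot a b Aa Ab) => /asboolP ab.
        rewrite (le_trans (qle _ _ Ab))// (le_trans ((svalP b).1.1 _ _))//.
        by rewrite lerD2r.
      rewrite (le_trans (qle _ _ Aa))// (le_trans ((svalP a).1.1 _ _))//.
      by rewrite lerD2l.
    rewrite -ler_pdivrMl//; apply: lb_le_inf; first by case: (Sinf x).
    move=> _ [a Aa <-]; rewrite ler_pdivrMl//.
    by rewrite (le_trans (qle _ _ Aa))// (svalP a).1.2.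
  have qp x : q x <= p x by rewrite (le_trans (qle _ _ Aa0))// (svalP a0).2.
  exists (exist _ q (conj qS qp)) => a Aa; apply/asboolP => x /=; exact: qle.
- exists (sval m); first exact: svalP m.
  move=> q qS qm.
  have qp x : q x <= p x by rewrite (le_trans (qm x))// (svalP m).2.
  have /mmin/(congr1 sval) // : r m (exist _ q (conj qS qp)).
  by apply/asboolP.
Qed.

Lemma cone_ray p (x : V) : sublinear p ->
  cone [set (t *: x, t * p x) | t in [set t | 0 <= t]].
Proof.
move=> pS; split.
- by exists 0 => //=; rewrite scale0r mul0r.
- move=> _ _ [s s0 <-] [t t0 <-]; exists (s + t); first exact: addr_ge0.
  by rewrite scalerDl mulrDl.
- move=> s _ s0 [t t0 <-]; exists (s * t); first by rewrite /= mulr_ge0// ltW.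
  by rewrite /= scalerA mulrA.
Qed.

(** A minimal sublinear functional is linear: its reduction by the ray of [x] is
    not smaller, which means that [f (- x) <= - f x]. Apply this to a minimal
    functional below the reduction of [p] by [G]. *)
Theorem Mazur_Orlicz p G : sublinear p -> cone G ->
  (forall a, G a -> a.2 <= p a.1) ->
  exists2 f : V -> R, scalar f /\ (forall x, f x <= p x) &
    forall a, G a -> a.2 <= f a.1.
Proof.
move=> pS Gc Gp; have [q [qS qp qG]] := sublinear_reduce pS Gc Gp.
have [f [fS fq] fmin] := sublinear_minimal qS.
(* The ray of [x] is a cone of constraints met by [f] with equality. *)
have fN x : f (- x) = - f x.
  have [|r [rS rf rG]] := sublinear_reduce fS (cone_ray x fS).
    move=> _ [t /= t0 <-] /=; move: t0; rewrite le_eqVlt => /predU1P[<-|t0].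
      by rewrite scale0r mul0r (sublinear0 fS).
    have := fS.2 t^-1 (t *: x); rewrite invr_gt0 => /(_ t0).
    by rewrite scalerA mulVf ?gt_eqF// scale1r ler_pdivlMl.
  have := rG (x, f x); rewrite (fmin _ rS rf) /= => H.
  apply/eqP; rewrite eq_le H; last by exists 1; rewrite /= ?scale1r ?mul1r.
  by have := sublinearN (- x) fS; rewrite opprK; lra.
have fD x y : f (x + y) = f x + f y.
  apply/eqP; rewrite eq_le fS.1 /=.
  by have := fS.1 (x + y) (- y); rewrite addrK fN; lra.
have fZp t x : 0 < t -> f (t *: x) = t * f x.
  move=> t0; apply/eqP; rewrite eq_le fS.2//=.
  have := fS.2 t^-1 (t *: x); rewrite invr_gt0 => /(_ t0).
  by rewrite scalerA mulVf ?gt_eqF// scale1r ler_pdivlMl.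
have fZ t x : f (t *: x) = t * f x.
  have [t0|t0|->] := ltgtP t 0; last by rewrite scale0r mul0r (sublinear0 fS).
    by have := fZp (- t) x; rewrite oppr_gt0 scaleNr fN mulNr => /(_ t0)/oppr_inj.
  exact: fZp.
exists f; first split.
- by move=> t x y; rewrite fD fZ.
- by move=> x; rewrite (le_trans (fq x)).
- by move=> a Ga; have := le_trans (fq _) (qG _ Ga); rewrite fN; lra.
Qed.

Corollary Hahn_Banach p (x : V) : sublinear p ->
  exists2 f : V -> R, scalar f /\ (forall y, f y <= p y) & f x = p x.
Proof.
move=> pS; have [|f [fl fp] fG] := Mazur_Orlicz pS (cone_ray x pS).
  move=> _ [t /= t0 <-] /=; move: t0; rewrite le_eqVlt => /predU1P[<-|t0].
    by rewrite scale0r mul0r (sublinear0 pS).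
  have := pS.2 t^-1 (t *: x); rewrite invr_gt0 => /(_ t0).
  by rewrite scalerA mulVf ?gt_eqF// scale1r ler_pdivlMl.
exists f => //; apply/eqP; rewrite eq_le fp /=; apply: (fG (x, p x)).
by exists 1; rewrite /= ?scale1r ?mul1r.
Qed.

End mazur_orlicz.

(** * Weak limits in reflexive spaces *)

Lemma convex_setP (R : realType) (M : lmodType R) (C : set M) :
  convex_set C <-> forall x y (t : R), C x -> C y -> 0 <= t <= 1 ->
    C (t *: x + (1 - t) *: y).
Proof.
split=> [cC x y t Cx Cy /andP[t0 t1]|cC x y t /set_mem Cx /set_mem Cy].
  by have := cC x y (Itv01 t0 t1) (mem_set Cx) (mem_set Cy); rewrite inE.
by rewrite inE; apply: cC => //; apply/andP.
Qed.

Section scalar_forms.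
Context (R : realType) (X : lmodType R).
Implicit Types (f : X -> R).

Lemma scalar_formB f x y : scalar f -> f (x - y) = f x - f y.
Proof. by move=> fl; rewrite addrC -scaleN1r fl mulN1r addrC. Qed.

Lemma scalar_form0 f : scalar f -> f 0 = 0.
Proof. by move=> fl; rewrite -(subrr 0) scalar_formB// subrr. Qed.

Lemma scalar_formZ f (t : R) x : scalar f -> f (t *: x) = t * f x.
Proof. by move=> fl; have := fl t x 0; rewrite addr0 scalar_form0// addr0. Qed.

Lemma scalar_formD f x y : scalar f -> f (x + y) = f x + f y.
Proof. by move=> fl; have := fl 1 x y; rewrite scale1r mul1r. Qed.

End scalar_forms.

Section dual_facts.
Context (R : realType) (X : normedModType R).
Implicit Types (f : X -> R).

Lemma dual_of_le_norm f : scalar f -> (forall x, f x <= `|x|) -> dual f.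
Proof.
move=> fl fn; split=> //; apply: continuous_of_lipschitz1 => x y.
by have := fn (x - y); rewrite scalar_formB//; lra.
Qed.

Lemma has_sup_dual_norm f : dual f ->
  has_sup [set `|f x| | x in [set x : X | `|x| <= 1]].
Proof.
move=> [fl fc].
have f0 : f 0 = 0 by exact: scalar_form0.
have [d d0 fd] : exists2 d : R, 0 < d & forall x, `|x| < d -> `|f x| < 1.
  have /cvgrPdist_lt/(_ _ ltr01) := fc 0; move=> /nbhs_ballP[d /= d0 H].
  exists d => // y yd; have := H y; rewrite -ball_normE /= sub0r normrN.
  by rewrite f0 sub0r normrN; exact.
split; first by exists `|f 0|, 0 => //=; rewrite normr0.
exists (2 / d) => _ [y /= y1 <-].
have d20 : 0 < d / 2 by rewrite divr_gt0.
have : `|f ((d / 2) *: y)| < 1.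
  apply: fd; rewrite normrZ gtr0_norm//.
  have : d / 2 * `|y| <= d / 2 by rewrite ler_piMr// ltW.
  lra.
rewrite scalar_formZ// normrM gtr0_norm// mulrC -ltr_pdivlMr// mul1r invf_div.
exact: ltW.
Qed.

Lemma dual_norm_ge0 f : dual f -> 0 <= dual_norm f.
Proof.
move=> /has_sup_dual_norm hs; apply: (@le_trans _ _ `|f 0|) => //.
by apply: ub_le_sup; [case: hs|exists 0 => //=; rewrite normr0].
Qed.

Lemma dual_norm_ub f x : dual f -> `|f x| <= `|x| * dual_norm f.
Proof.
move=> fd; have [fl fc] := fd.
have [->|x0] := eqVneq x 0; first by rewrite scalar_form0// !normr0 mul0r.
have nx : 0 < `|x| by rewrite normr_gt0.
rewrite -ler_pdivrMl//; apply: ub_le_sup.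
  by case: (has_sup_dual_norm fd).
exists (`|x|^-1 *: x) => /=.
  by rewrite normrZ normfV normr_id mulVf ?gt_eqF.
by rewrite scalar_formZ// normrM normfV normr_id.
Qed.

(** The Mazur-Orlicz theorem for the norm and the constraints that are multiples of
    [(c - u, d)], where [d] is the radius of a ball around [u] that misses [C]. *)
Lemma separation (C : set X) u : C !=set0 -> convex_set C -> ~ closure C u ->
  exists f, dual f /\ exists2 d : R, 0 < d & forall c, C c -> f u + d <= f c.
Proof.
move=> [c0 Cc0] /convex_setP Cc.
move=> /existsNP[U /not_implyP[/nbhs_ballP[d /= d0 dU] CU]].
have Cd c : C c -> d <= `|c - u|.
  move=> Cc'; rewrite leNgt; apply/negP => cu; apply: CU; exists c; split=> //.
  by apply: dU; rewrite -ball_normE /= distrC.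
pose G : set (X * R) := [set a | exists t c, [/\ 0 <= t, C c &
  a = (t *: (c - u), t * d)]].
have nS : sublinear (fun x : X => `|x|).
  split; first exact: ler_normD.
  by move=> t x t0; rewrite normrZ gtr0_norm.
have Gc : cone G.
  split.
  - by exists 0, c0; split=> //; rewrite scale0r mul0r.
  - move=> _ _ [s [b [s0 Cb ->]]] [t [c [t0 Ccc ->]]].
    have [st0|st0] := eqVneq (s + t) 0.
      have /andP[/eqP -> /eqP ->] : (s == 0) && (t == 0) by rewrite -paddr_eq0// st0.
      by exists 0, c0; split=> //; rewrite !scale0r !mul0r; congr (_, _); rewrite addr0.
    have st : 0 < s + t by rewrite lt_neqAle eq_sym st0 addr_ge0.
    exists (s + t), ((s / (s + t)) *: b + (1 - s / (s + t)) *: c); split.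
    + exact: ltW.
    + apply: Cc => //; rewrite divr_ge0 ?(ltW st)//= ler_pdivrMr// mul1r.
      by rewrite lerDl.
    + have -> : 1 - s / (s + t) = t / (s + t).
        by rewrite -[X in X - _](divff st0) -mulrBl addrAC subrr add0r.
      congr (_, _); last by rewrite /= mulrDl.
      rewrite /= !scalerBr scalerDr !scalerA !(mulrC (s + t)) !divfK//.
      by rewrite addrACA -opprD -scalerDl.
  - move=> t _ t0 [s [c [s0 Ccc ->]]]; exists (t * s), c; split=> //.
      by rewrite mulr_ge0// ltW.
    by rewrite /= scalerA mulrA.
have [a|f [fl fn] fG] := Mazur_Orlicz nS Gc.
  move=> [t [c [t0 Ccc ->]]] /=.
  by rewrite normrZ ger0_norm// ler_wpM2l// Cd.
exists f; split; first exact: dual_of_le_norm.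
exists d => // c Ccc; have := fG (c - u, d); rewrite /= scalar_formB//.
suff Gcd : G (c - u, d) by move=> /(_ Gcd); lra.
by exists 1, c; rewrite scale1r mul1r.
Qed.

End dual_facts.

Section weak_compactness.
Context (R : realType) (X : normedModType R).

(** The limit is the supremum of the numbers that are below [g] on a member of [F]. *)
Lemma ultrafilter_cvg_bounded (T : Type) (F : set_system T) (g : T -> R) (M : R) :
  UltraFilter F -> F [set x | `|g x| <= M] ->
  exists l : R, g x @[x --> F] --> l.
Proof.
move=> FU FM.
pose S := [set r | F [set x | r <= g x]].
have S_ub : ubound S M.
  move=> r Sr; have [x [/= rx xM]] := filter_ex (filterI Sr FM).
  by rewrite (le_trans rx)// (le_trans (ler_norm _)).
have hs : has_sup S.
  split; last by exists M.
  exists (- M); apply: filterS FM => x /=; rewrite ler_norml => /andP[]//.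
exists (sup S); apply/cvgrPdist_le => e e0.
have [r Sr rS] := sup_adherent e0 hs.
have Fe : F [set x | g x < sup S + e].
  have [H|] := in_ultra_setVsetC [set x | sup S + e <= g x] FU; last first.
    by apply: filterS => x /= /negP; rewrite -ltNge.
  have := sup_upper_bound hs H; lra.
near=> x.
have rx : r <= g x by near: x.
have xe : g x < sup S + e by near: x.
by rewrite ler_norml; lra.
Unshelve. all: by end_near. Qed.

(** The limits of the continuous linear forms along [F] make up a bounded linear
    functional on the dual, which by reflexivity is the evaluation at a point
    [u]. If [u] were not in the closure of a convex member of [F], a linear form
    that separates them strictly could not tend to its value at [u]. This plays
    the role of the weak compactness of [K] together with Mazur's lemma. *)
Theorem reflexive_ultrafilter (K : set X) (F : set_system X) :
  reflexive_space X -> bounded_set K -> UltraFilter F -> F K ->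
  exists2 u, forall f, dual f -> f x @[x --> F] --> f u &
    forall C, F C -> convex_set C -> closure C u.
Proof.
move=> Xr Kb FU FK.
have [M M0 KM] : exists2 M : R, 0 < M & forall x, K x -> `|x| <= M.
  have [M0 [_ HM]] := Kb; exists (`|M0| + 1); first by rewrite ltr_wpDl.
  by move=> x; apply: HM; rewrite (le_lt_trans (ler_norm _))// ltrDl.
pose L (f : X -> R) : R := lim (f x @[x --> F]).
have fM f : dual f -> F [set x | `|f x| <= M * dual_norm f].
  move=> fd; apply: filterS FK => x /KM xM /=. 
  rewrite (le_trans (dual_norm_ub x fd))// ler_wpM2r//.
  exact: dual_norm_ge0.
have Lc f : dual f -> f x @[x --> F] --> L f.
  by move=> fd; have [l fl] := ultrafilter_cvg_bounded FU (fM f fd); apply: cvgP fl.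
have [a f g fd gd||u uL] := Xr L.
- apply/cvg_lim => //; apply: cvgD; last exact: Lc.
  by apply: cvgMr; exact: Lc.
- exists M => f fd.
  have /cvg_norm := Lc f fd; move=> H; rewrite -(cvg_lim _ H)//.
  by apply: limr_le; [exact: cvgP H|exact: fM].
have uF f : dual f -> f x @[x --> F] --> f u.
  by move=> fd; rewrite -uL//; exact: Lc.
exists u => // C FC Cc; apply: contrapT => Cu.
have C0 : C !=set0 by exact: filter_ex FC.
have [f [fd [d d0 fC]]] := separation C0 Cc Cu.
have : f u + d <= f u.
  rewrite -[leRHS](cvg_lim _ (uF f fd))//; apply: limr_ge.
    exact: cvgP (uF f fd).
  by apply: filterS FC.
by lra.
Qed.

End weak_compactness.

(** * Lebesgue measure of open sets and bounded sets *)

Lemma length_split (R : realType) (a b c : R) :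
  Num.max 0 (b - a) = Num.max 0 (Num.min b c - a) + Num.max 0 (b - Num.max a c).
Proof.
by have [?|?] := leP b c; have [?|?] := leP a c;
  do ?[case: (leP 0 _) => ?]; lra.
Qed.

Section lebesgue_open.
Context (R : realType) (N : nat).
Local Notation E := 'rV[R]_N.+1.
Local Notation mu := (lebesgue_rV R N).
Local Notation S := (lebesgue_rV_type R N).

Definition halfspace (i : 'I_N.+1) (c : R) : set E := [set x | x ord0 i < c].

Definition box_below i c (ab : E * E) : E * E :=
  (ab.1, \row_j if j == i then Num.min (ab.2 ord0 i) c else ab.2 ord0 j).

Definition box_above i c (ab : E * E) : E * E :=
  (\row_j if j == i then Num.max (ab.1 ord0 i) c else ab.1 ord0 j, ab.2).

Lemma box_volume_split i c ab :
  box_volume ab = box_volume (box_below i c ab) + box_volume (box_above i c ab).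
Proof.
rewrite /box_volume (bigD1 i)//= [in RHS](bigD1 i)//=.
rewrite [X in _ = _ + X](bigD1 i)//= !mxE eqxx.
under [X in _ = _ * X + _]eq_bigr => j ji do rewrite !mxE (negPf ji).
under [X in _ = _ + _ * X]eq_bigr => j ji do rewrite !mxE (negPf ji).
rewrite -mulrDl; congr (_ * _).
exact: length_split.
Qed.

(** A hyperplane parallel to the coordinate axes cuts each box of a cover into two
    boxes whose volumes add up to that of the box. *)
Lemma halfspace_measurable i c : measurable (halfspace i c : set S).
Proof.
apply: le_caratheodory_measurable => A.
apply: le_ereal_inf_tmp => _ [B AB <-].
have -> : (\sum_(k <oo) (box_volume (B k))%:E =
    \sum_(k <oo) (box_volume (box_below i c (B k)))%:E +
    \sum_(k <oo) (box_volume (box_above i c (B k)))%:E)%E.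
  rewrite -nneseriesD.
  - by apply: eq_eseriesr => k _; rewrite -EFinD -box_volume_split.
  - by move=> *; exact: box_volume_ge0.
  - by move=> *; exact: box_volume_ge0.
apply: leeD; apply: ereal_inf_lbound.
  exists (fun k => box_below i c (B k)) => // x [/AB[k _ xB] xc].
  exists k => // j /=; have /andP[xa xb] := xB j.
  rewrite /= mxE; case: eqP => [ji|_]; last by rewrite xa.
  by subst j; rewrite xa lt_min xb.
exists (fun k => box_above i c (B k)) => // x [/AB[k _ xB] /negP xc].
exists k => // j /=; have /andP[xa xb] := xB j.
rewrite /= mxE; case: eqP => [ji|_]; last by rewrite xa.
by subst j; rewrite xb andbT ge_max xa leNgt.
Qed.

Lemma box_measurable ab : measurable (box ab : set S).
Proof.
rewrite (_ : box ab = \bigcap_(i in [set: 'I_N.+1])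
    (halfspace i (ab.2 ord0 i) `\` halfspace i (ab.1 ord0 i))); last first.
  apply/seteqP; split=> [x xab i _|x xab i].
    have /andP[xa xb] := xab i; split=> //.
    by apply/negP; rewrite -leNgt.
  by have [xb /negP] := xab i I; rewrite -leNgt => ->.
apply: fin_bigcap_measurable => // i _.
by apply: measurableD; exact: halfspace_measurable.
Qed.

(** An open set is the union of the countably many boxes with rational corners in it. *)
Lemma open_lebesgue_measurable (U : set E) : open U -> measurable (U : set S).
Proof.
move=> Uo.
pose D := [set q : 'rV[rat]_N.+1 * 'rV[rat]_N.+1 |
  box (map_mx ratr q.1, map_mx ratr q.2) `<=` U].
rewrite (_ : U = \bigcup_(q in D) box (map_mx ratr q.1, map_mx ratr q.2)).
  rewrite bigcup_mkcond; apply: countable_bigcupT_measurable => [|q].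
    exact: countableP.
  by case: ifP => // _; exact: box_measurable.
apply/seteqP; split=> [x Ux|x [q Dq /Dq]//].
have /nbhs_ballP[e /= e0 xU] : nbhs x U by apply: open_nbhs_nbhs.
have /choice[a aP] i : exists a : rat, ratr a \in `]x ord0 i - e / 2, x ord0 i[.
  by apply: rat_in_itvoo; rewrite ltrBlDr ltrDl divr_gt0.
have /choice[b bP] i : exists b : rat, ratr b \in `]x ord0 i, x ord0 i + e / 2[.
  by apply: rat_in_itvoo; rewrite ltrDl divr_gt0.
exists (\row_i a i, \row_i b i) => /= [|i]; last first.
  by rewrite !mxE /=; have := aP i; have := bP i; rewrite !in_itv /=; lra.
move=> y yab; apply: xU; rewrite -ball_normE /=.
apply: (@le_lt_trans _ _ (e / 2)); last by rewrite ltr_pdivrMr// ltr_pMr// ltr1n.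
apply: mxnorm_le => [|i]; first by rewrite ltW// divr_gt0.
have := yab i; rewrite !mxE /=; have := aP i; have := bP i.
by rewrite !in_itv /= ler_norml; lra.
Qed.

Lemma bounded_lebesgue_finite (A : set E) : bounded_set A -> (mu A < +oo)%E.
Proof.
move=> [M [_ AM]]; pose L := `|M| + 1.
have AL x : A x -> `|x| <= L.
  by move=> Ax; apply: AM => //; rewrite (le_lt_trans (ler_norm _))// ltrDl.
pose B (k : nat) : E * E :=
  (* The boxes are half-open, hence the margin on the upper side. *)
  if k == 0%N then (const_mx (- L), const_mx (L + 1)) else (0, 0).
have : (mu A <= \sum_(k <oo) (box_volume (B k))%:E)%E.
  apply: ereal_inf_lbound; exists B => // x /AL xL; exists 0%N => // i.
  rewrite !mxE; have := le_trans (ler_mxnorm x i) xL; rewrite ler_norml => /andP[-> /=].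
  by move/le_lt_trans; apply; rewrite ltrDl.
move/le_lt_trans; apply.
rewrite (nneseriesD1 (n := 0%N))//=; last by move=> *; exact: box_volume_ge0.
rewrite eseries0 ?adde0 ?ltry// => k _ k0.
by rewrite /B (negPf k0) /box_volume big_ord_recl/= mxE subr0 maxxx mul0r.
Qed.

End lebesgue_open.

(** * Clarke's generalized directional derivative *)

Lemma continuous_at_dist (R : realType) (V : normedModType R) (f : V -> R) y :
  (forall e : R, 0 < e -> exists2 d : R, 0 < d &
    forall z, `|y - z| < d -> `|f y - f z| <= e) -> {for y, continuous f}.
Proof.
move=> H; apply/cvgrPdist_le => e /H[d d0 Hd]; apply/nbhs_ballP.
by exists d => // z; rewrite -ball_normE; exact: Hd.
Qed.

Section clarke_calculus.
Context (R : realType) (k : nat).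
Implicit Types (f : 'rV[R]_k -> R) (y z h w : 'rV[R]_k) (c d l : R).

Definition diff_quot f h w l := (f (w + l *: h) - f w) / l.

(** Upper bounds of the difference quotients near [y], with an explicit radius: all
    that is needed of the upper limit in the definition of Clarke's derivative. *)
Definition quot_bound f y h c := exists2 d : R, 0 < d &
  forall w l, `|y - w| < d -> 0 < l < d -> diff_quot f h w l <= c.

Lemma quot_bound_clarke f y h c :
  quot_bound f y h c -> (clarke_derivative f y h <= c%:E)%E.
Proof.
move=> [d d0 H].
pose V := [set wl : 'rV[R]_k * R | ball y d wl.1 /\ 0 < wl.2 < d].
apply: (@le_trans _ _ (ereal_sup
  [set ((f (wl.1 + wl.2 *: h) - f wl.1) / wl.2)%:E | wl in V])).
  apply: ereal_inf_lbound; exists V => //.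
  exists (ball y d, [set l | 0 < l < d]).
    split=> /=; first exact: nbhsx_ballx.
    near=> l; apply/andP; split; near: l; first exact: nbhs_right_gt.
    exact: nbhs_right_lt.
  by move=> [w l] [].
apply: ge_ereal_sup => _ [[w l] [/= yw l0] <-].
by rewrite lee_fin; apply: H => //; rewrite -ball_normE in yw.
Unshelve. all: by end_near. Qed.

Lemma clarke_quot_bound f y h c :
  (clarke_derivative f y h < c%:E)%E -> quot_bound f y h c.
Proof.
move=> /ereal_inf_lt[_ [V [[A B] /= [Ay B0] ABV] <-] /ltW supc].
have [a /= a0 aA] : nbhs_ball y A by apply/nbhs_ballP.
have [b /= b0 bB] : nbhs_ball 0 (fun l : R => 0 < l -> B l).
  by apply/nbhs_ballP.
exists (Num.min a b) => [|w l]; first by rewrite lt_min a0.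
rewrite lt_min => /andP[ywa _]; rewrite lt_min => /andP[l0 /andP[_ lb]].
rewrite -lee_fin; apply: le_trans supc; apply: ereal_sup_ubound.
exists (w, l) => //; apply: ABV; split=> /=.
  by apply: aA; rewrite -ball_normE.
by apply: bB => //; rewrite -ball_normE /= sub0r normrN gtr0_norm.
Qed.

Variable f : 'rV[R]_k -> R.
Hypothesis fL : locally_lipschitz f.

Lemma locally_lipschitz_ball y : exists L d, [/\ 0 <= L, 0 < d &
  forall w w', `|y - w| < d -> `|y - w'| < d -> `|f w - f w'| <= L * `|w - w'|].
Proof.
have [U /nbhs_ballP[d /= d0 dU] [M [_ HM]]] := fL y.
exists (`|M| + 1), d; split=> // w w' yw yw'.
have := HM (`|M| + 1); rewrite (le_lt_trans (ler_norm _)) ?ltrDl// => /(_ isT (w, w')).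
by apply; split=> /=; apply: dU; rewrite -ball_normE.
Qed.

Lemma locally_lipschitz_continuous : continuous f.
Proof.
move=> y; have [L [d [L0 d0 H]]] := locally_lipschitz_ball y.
have L1 : 0 < L + 1 by rewrite ltr_wpDl.
apply: continuous_at_dist => e e0.
exists (Num.min d (e / (L + 1))) => [|z]; first by rewrite lt_min d0 divr_gt0.
rewrite lt_min => /andP[yz yze].
rewrite (le_trans (H _ _ _ yz)) ?subrr ?normr0//.
have : `|y - z| * (L + 1) <= e by rewrite -ler_pdivlMr// ltW.
have : 0 <= `|y - z| by [].
rewrite mulrDr mulr1 [L * _]mulrC; lra.
Qed.

Lemma diff_quot_lipschitz y : exists L d, [/\ 0 <= L, 0 < d &
  forall w l h h', `|y - w| < d -> 0 < l -> l * `|h| < d -> l * `|h'| < d ->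
    diff_quot f h w l <= diff_quot f h' w l + L * `|h - h'|].
Proof.
have [L [d [L0 d0 H]]] := locally_lipschitz_ball y.
exists L, (d / 2); split=> //; first by rewrite divr_gt0.
move=> w l h h' yw l0 lh lh'.
have near_y g : l * `|g| < d / 2 -> `|y - (w + l *: g)| < d.
  move=> lg; rewrite opprD addrA (le_lt_trans (ler_normD _ _))//.
  by rewrite normrN normrZ gtr0_norm//; lra.
rewrite -lerBlDl /diff_quot -mulrBl ler_pdivrMr//.
rewrite opprB addrA subrK.
rewrite (le_trans (ler_norm _))// (le_trans (H _ _ (near_y _ lh) (near_y _ lh')))//.
rewrite opprD addrACA subrr add0r -scalerBr normrZ gtr0_norm//.
by rewrite mulrA mulrAC.
Qed.

Lemma diff_quot0 w l : diff_quot f 0 w l = 0.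
Proof. by rewrite /diff_quot scaler0 addr0 subrr mul0r. Qed.

Lemma small_scale h d : 0 < d -> exists2 e : R, 0 < e &
  forall l, 0 < l < e -> l * `|h| < d.
Proof.
move=> d0; have h1 : 0 < `|h| + 1 by rewrite ltr_wpDl.
exists (d / (`|h| + 1)) => [|l /andP[l0]]; first by rewrite divr_gt0.
by rewrite ltr_pdivlMr//; apply: le_lt_trans; rewrite ler_pM2l// lerDl.
Qed.

Lemma clarke_fin y h : clarke_derivative f y h \is a fin_num.
Proof.
have [L [d [L0 d0 H]]] := diff_quot_lipschitz y.
have [e e0 He] := small_scale h d0.
rewrite fin_numE; apply/andP; split; apply/eqP => D.
  have /clarke_quot_bound[e' e'0 /(_ y)] :
    (clarke_derivative f y h < (- (L * `|h|) - 1)%:E)%E by rewrite D ltNyr.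
  pose l := Num.min (e / 2) (e' / 2).
  have l0 : 0 < l by rewrite lt_min !divr_gt0.
  have le : l < e by rewrite gt_min [X in X || _]ltr_pdivrMr// ltr_pMr ?ltr1n.
  have le' : l < e'.
    by rewrite gt_min [X in _ || X]ltr_pdivrMr// ltr_pMr ?ltr1n// orbT.
  move=> /(_ l); rewrite subrr normr0 l0 le' => /(_ e'0 isT).
  have := H y l 0 h; rewrite subrr normr0 d0 mulr0 d0 l0.
  rewrite He ?l0// => /(_ isT isT isT isT).
  by rewrite diff_quot0 sub0r normrN; lra.
have /quot_bound_clarke : quot_bound f y h (L * `|h|).
  exists (Num.min d e) => [|w l]; first by rewrite lt_min d0.
  rewrite lt_min => /andP[yw _]; rewrite lt_min => /andP[l0 /andP[_ le]].
  have := H w l h 0; rewrite subr0 normr0 mulr0 d0 l0 diff_quot0 add0r.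
  by apply=> //; apply: He; rewrite l0.
by rewrite D leNgt ltry.
Qed.

Definition clarke_fine y h : R := fine (clarke_derivative f y h).

Lemma clarke_fineE y h : clarke_derivative f y h = (clarke_fine y h)%:E.
Proof. by rewrite fineK ?clarke_fin. Qed.

Lemma quot_bound_le y h c : quot_bound f y h c -> clarke_fine y h <= c.
Proof. by move=> /quot_bound_clarke; rewrite clarke_fineE lee_fin. Qed.

Lemma quot_bound_lt y h c : clarke_fine y h < c -> quot_bound f y h c.
Proof. by rewrite -lte_fin -clarke_fineE; exact: clarke_quot_bound. Qed.

(** The quotient along [g + h] at [w] is the sum of the quotient along [h] at [w] and
    the quotient along [g] at [w + l *: h], a point that tends to [y] as well. *)
Lemma clarke_sublinear y : sublinear (clarke_fine y).
Proof.
split=> [g h|t h t0].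
  apply/ler_addgt0Pr => e e0.
  have [|a a0 Ha] := @quot_bound_lt y g (clarke_fine y g + e / 2).
    by rewrite ltrDl divr_gt0.
  have [|b b0 Hb] := @quot_bound_lt y h (clarke_fine y h + e / 2).
    by rewrite ltrDl divr_gt0.
  have a20 : 0 < a / 2 by rewrite divr_gt0.
  have [s s0 Hs] := small_scale h a20.
  apply: quot_bound_le; exists (Num.min (a / 2) (Num.min b s)) => [|w l].
    by rewrite !lt_min a20 b0.
  rewrite !lt_min => /and3P[ywa ywb yws] /and4P[l0 la lb ls].
  have Hg := Ha (w + l *: h) l.
  have Hh := Hb w l ywb; rewrite l0 lb in Hh.
  have -> : diff_quot f (g + h) w l =
      diff_quot f g (w + l *: h) l + diff_quot f h w l.
    rewrite /diff_quot -mulrDl scalerDr addrA; congr (_ / _).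
    by rewrite addrA subrK (addrAC w).
  have Hg' : diff_quot f g (w + l *: h) l <= clarke_fine y g + e / 2.
    apply: Hg; last by rewrite l0 /=; lra.
    rewrite opprD addrA (le_lt_trans (ler_normD _ _))// normrN normrZ.
    have := Hs l; rewrite l0 ls gtr0_norm// => /(_ isT); lra.
  have := Hh isT; lra.
rewrite -ler_pdivrMl//; apply/ler_addgt0Pr => e e0.
have [|a a0 Ha] := @quot_bound_lt y h (clarke_fine y h + e).
  by rewrite ltrDl.
rewrite ler_pdivrMl//; apply: quot_bound_le.
exists (Num.min a (a / t)) => [|w l]; first by rewrite lt_min a0 divr_gt0.
rewrite !lt_min => /andP[ywa _] /and3P[l0 _ lat].
have := Ha w (l * t) ywa; rewrite mulr_gt0// -ltr_pdivlMr// lat => /(_ isT).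
rewrite /diff_quot scalerA ler_pdivrMr ?mulr_gt0// => H.
by rewrite ler_pdivrMr//; lra.
Qed.

(** Moving the base point only shrinks the radius on which the quotients are
    bounded; moving the direction changes the quotients by at most the Lipschitz
    constant times the distance. *)
Lemma clarke_usc y h c : clarke_fine y h < c -> exists2 d : R, 0 < d &
  forall y' h', `|y - y'| < d -> `|h - h'| < d -> clarke_fine y' h' <= c.
Proof.
move=> hc; pose c0 := (clarke_fine y h + c) / 2.
have [L [dL [L0 dL0 HL]]] := diff_quot_lipschitz y.
have [|a a0 Ha] := @quot_bound_lt y h c0; first by rewrite /c0; lra.
have e0 : 0 < (c - c0) / (L + 1).
  by apply: divr_gt0; [rewrite /c0; lra|rewrite ltr_wpDl].
pose m := Num.min a dL.
have m0 : 0 < m by rewrite lt_min a0.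
exists (Num.min (m / 2) ((c - c0) / (L + 1))) => [|y' h'].
  by rewrite lt_min e0 divr_gt0.
rewrite !lt_min => /andP[yy' _] /andP[_ hh'].
have [s s0 Hs] := small_scale h dL0.
have [s' s'0 Hs'] := small_scale h' dL0.
apply: quot_bound_le; exists (Num.min (m / 2) (Num.min s s')) => [|w l].
  by rewrite !lt_min s0 s'0 divr_gt0.
rewrite !lt_min => /and3P[y'w _ _] /and4P[l0 lm ls ls'].
have ywm : `|y - w| < m.
  have -> : y - w = (y - y') + (y' - w) by rewrite addrA subrK.
  by rewrite (le_lt_trans (ler_normD _ _))//; lra.
move: ywm; rewrite lt_min => /andP[ywa ywL].
have lm' : l < m by lra.
move: lm'; rewrite lt_min => /andP[lma lmL].
have := HL w l h' h ywL l0; rewrite Hs ?l0// Hs' ?l0// => /(_ isT isT).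
have := Ha w l ywa; rewrite l0 lma => /(_ isT) q1 q2.
rewrite (le_trans q2)//.
have : `|h - h'| * (L + 1) <= c - c0 by rewrite -ler_pdivlMr ?ltr_wpDl// ltW.
have : 0 <= `|h - h'| by [].
rewrite mulrDr mulr1 (distrC h') [L * _]mulrC; lra.
Qed.

Lemma enorm_ge z i : `|z ord0 i| <= enorm z.
Proof.
rewrite -sqrtr_sqr ler_sqrt; last by apply: sumr_ge0 => j _; rewrite -expr2 sqr_ge0.
rewrite /edot (bigD1 i)//= expr2 lerDl.
by apply: sumr_ge0 => j _; rewrite -expr2 sqr_ge0.
Qed.

(** By the Hahn-Banach theorem, Clarke's derivative along [h] is the value at [h] of
    an element of the generalized gradient. *)
Lemma clarke_growth y h c : (forall z, clarke_gradient f y z -> enorm z <= c) ->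
  `|clarke_fine y h| <= k%:R * c * `|h|.
Proof.
move=> Hc.
have ub g : clarke_fine y g <= k%:R * c * `|g|.
  have [u [ul up] <-] := Hahn_Banach g (clarke_sublinear y).
  pose z := \row_i u (delta_mx ord0 i).
  have uE v : u v = edot z v.
    rewrite {1}(row_sum_delta v) /edot.
    rewrite (big_morph u (fun a b => scalar_formD a b ul) (scalar_form0 ul)).
    by apply: eq_bigr => i _; rewrite (scalar_formZ _ _ ul) mxE mulrC.
  have zc : enorm z <= c.
    by apply: Hc => v; rewrite -uE clarke_fineE lee_fin.
  rewrite uE /edot.
  apply: (@le_trans _ _ (\sum_(i < k) c * `|g|)).
    apply: ler_sum => i _; rewrite (le_trans (ler_norm _))// normrM ler_pM//.
      exact: le_trans (enorm_ge z i) zc.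
    exact: ler_mxnorm.
  by rewrite sumr_const card_ord -(mulr_natl (c * _)) mulrA.
rewrite ler_norml ub andbT.
have := sublinearN h (clarke_sublinear y); have := ub (- h).
by rewrite normrN; lra.
Qed.

End clarke_calculus.

(** * Measurability of superpositions *)

Section density.
Context (R : realType) (V : normedModType R).

Lemma continuous_at_distE (g : V -> R) v : {for v, continuous g} ->
  forall e : R, 0 < e -> exists2 d : R, 0 < d &
    forall z, `|v - z| < d -> `|g v - g z| <= e.
Proof.
move=> gc e e0; have /cvgrPdist_le/(_ e e0)/nbhs_ballP[d /= d0 dP] := gc.
by exists d => // z vz; apply: dP; rewrite -ball_normE.
Qed.

Lemma le_of_dense (g : V -> R) v c : {for v, continuous g} ->
  (forall e : R, 0 < e -> exists2 v', `|v - v'| < e & g v' <= c) -> g v <= c.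
Proof.
move=> gc H; apply/ler_addgt0Pr => e e0.
have [d d0 dP] := continuous_at_distE gc e0.
have [v' vv' gv'] := H d d0.
have : `|g v - g v'| <= e by exact: dP.
by rewrite ler_norml; lra.
Qed.

Lemma continuous_translate (f : V -> R) a :
  continuous f -> continuous (fun v => f (a + v)).
Proof.
move=> fc v; apply: continuous_comp; last exact: fc.
by apply: cvgD; [exact: cvg_cst|exact: cvg_id].
Qed.

Lemma continuous_line (f : V -> R) a h :
  continuous f -> continuous (fun l : R => f (a + l *: h)).
Proof.
move=> fc l; apply: continuous_comp; last exact: fc.
by apply: cvgD; [exact: cvg_cst|apply: cvgZr_tmp; exact: cvg_id].
Qed.
Lemma continuous_subr (f g : V -> R) :
  continuous f -> continuous g -> continuous (fun v => f v - g v).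
Proof. by move=> fc gc v; apply: cvgB; [exact: fc|exact: gc]. Qed.

End density.

Section vectors.
Context (R : realType) (k : nat).

Lemma mxnorm_ltP (x : 'rV[R]_k) (r : R) : 0 < r ->
  `|x| < r <-> forall i, `|x ord0 i| < r.
Proof.
move=> r0; split=> [xr i|xr]; first exact: le_lt_trans (ler_mxnorm x i) xr.
rewrite -[ltLHS]/(mx_norm x) mx_normrE.
by apply: bigmax_lt => // -[i j] _ /=; rewrite ord1.
Qed.

Lemma rat_vec_dense (y : 'rV[R]_k) (e : R) : 0 < e ->
  exists q : 'rV[rat]_k, `|y - map_mx ratr q| < e.
Proof.
move=> e0; have /choice[a aP] i :
    exists a : rat, ratr a \in `]y ord0 i - e, y ord0 i + e[.
  by apply: rat_in_itvoo; lra.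
exists (\row_i a i); apply/mxnorm_ltP => // i; rewrite !mxE.
by have := aP i; rewrite in_itv /= ltr_norml; lra.
Qed.
End vectors.

Section measurable_superposition.
Context d (S : measurableType d) (R : realType) (k : nat) (D : set S).
Hypothesis mD : measurable D.

Definition measurable_vec (g : S -> 'rV[R]_k) :=
  forall i, measurable_fun D (fun x => g x ord0 i).

Lemma measurable_lt (f : S -> R) c :
  measurable_fun D f -> measurable (D `&` [set x | f x < c]).
Proof.
move=> mf; rewrite -[X in _ `&` X]/(f @^-1` [set r | r < c]).
by rewrite -set_itvNyo; apply: mf.
Qed.

Lemma measurable_le (f : S -> R) c :
  measurable_fun D f -> measurable (D `&` [set x | f x <= c]).
Proof.
move=> mf; rewrite -[X in _ `&` X]/(f @^-1` [set r | r <= c]).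
by rewrite -set_itvNyc; apply: mf.
Qed.

Lemma measurable_fun_lt (f : S -> R) :
  (forall c, measurable (D `&` [set x | f x < c])) -> measurable_fun D f.
Proof.
move=> H _; apply: (measurability _ (RGenInftyO.measurableE R)) => //.
by move=> _ [_ [c ->] <-]; rewrite preimage_itvNyo; exact: H.
Qed.

Lemma measurable_imply (P Q : set S) :
  measurable (D `&` P) -> measurable (D `&` Q) ->
  measurable (D `&` [set x | P x -> Q x]).
Proof.
move=> mP mQ; rewrite (_ : _ `&` _ = (D `\` (D `&` P)) `|` (D `&` Q)).
  by apply: measurableU => //; exact: measurableD.
apply/seteqP; split=> [x [Dx PQ]|x [[Dx nP]|[Dx Qx]]].
- by have [Px|nPx] := pselect (P x); [right; split=> //; exact: PQ|left; split=> // -[]].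
- by split=> // Px; exfalso; apply: nP.
- by split.
Qed.

(** Criterion for functions, like upper limits, whose strict sublevel sets are given
    by countably many inequalities, the [j]-th one being imposed only where
    [P i j] holds. *)
Lemma measurable_fun_countable (I J : countType) (C : I -> R -> Prop)
    (B : I -> J -> S -> R) (P : I -> J -> set S) (c' : I -> R) (f : S -> R) :
  (forall i j, measurable (D `&` P i j)) ->
  (forall i j, measurable_fun D (B i j)) ->
  (forall x c, D x -> f x < c <-> exists i, C i c /\
     forall j, P i j x -> B i j x <= c' i) ->
  measurable_fun D f.
Proof.
move=> mP mB fE; apply: measurable_fun_lt => c.
rewrite (_ : _ `&` _ = \bigcup_(i in [set i | C i c])
    ((\bigcap_(j in [set: J]) (D `&` [set x | P i j x -> B i j x <= c' i])) `&` D)).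
  rewrite bigcup_mkcond; apply: countable_bigcupT_measurable => [|i].
    exact: countableP.
  case: ifP => // _; apply: measurableI => //.
  rewrite -[X in measurable X]setCK setC_bigcap; apply: measurableC.
  apply: countable_bigcupT_measurable => [|j]; first exact: countableP.
  apply: measurableC; apply: measurable_imply => //.
  exact: measurable_le.
apply/seteqP; split=> [x [Dx /fE[//|i [Ci Hi]]]|x [i Ci [Hi Dx]]].
  by exists i => //; split=> // j _; split=> //; exact: Hi.
split=> //; apply/fE => //; exists i; split=> // j.
by have [_] := Hi j Logic.I.
Qed.

Lemma measurable_dist_lt (g : S -> 'rV[R]_k) q r : 0 < r -> measurable_vec g ->
  measurable (D `&` [set x | `|g x - q| < r]).
Proof.
move=> r0 mg; rewrite (_ : _ `&` _ = (\bigcap_(i in [set: 'I_k])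
   (D `&` [set x | `|g x ord0 i - q ord0 i| < r])) `&` D).
  apply: measurableI => //; apply: fin_bigcap_measurable => // i _.
  apply: measurable_lt; apply: measurableT_comp => //.
  by apply: measurable_funB; [exact: mg|exact: measurable_cst].
apply/seteqP; split=> [x [Dx H]|x [H Dx]].
  split=> // i _; split=> //=; have := (mxnorm_ltP _ r0).1 H i.
  by rewrite !mxE.
split=> //=; apply/mxnorm_ltP => // i; have [_ /=] := H i Logic.I.
by rewrite !mxE.
Qed.

Variable j : S -> 'rV[R]_k -> R.
Hypothesis mj : forall y, measurable_fun D (fun x => j x y).
Hypothesis jc : forall x, D x -> continuous (j x).

(** By continuity of [j x], a number [c] exceeds [j x (g x)] exactly if some rational
    number below [c] bounds [j x] at the rational points near [g x]. *)
Lemma measurable_superposition (g : S -> 'rV[R]_k) : measurable_vec g ->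
  measurable_fun D (fun x => j x (g x)).
Proof.
move=> mg.
apply: (@measurable_fun_countable (rat * nat)%type 'rV[rat]_k
  (fun i c => ratr i.1 < c)
  (fun i q x => j x (map_mx ratr q))
  (fun i q => [set x | `|g x - map_mx ratr q| < i.2.+1%:R^-1])
  (fun i => ratr i.1)) => [i q|i q|x c Dx].
- exact: measurable_dist_lt.
- exact: mj.
split=> [jgc|[[a n] /= [ac H]]].
  have [a] := rat_in_itvoo jgc; rewrite in_itv /= => /andP[ja ac].
  have ja0 : 0 < ratr a - j x (g x) by rewrite subr_gt0.
  have jg : {for g x, continuous (j x)} by exact: jc.
  have [e e0 eP] := continuous_at_distE jg ja0.
  have [n ne] : exists n, n.+1%:R^-1 < e.
    by have [N _ HN] := near_infty_natSinv_lt (PosNum e0); exists N; apply: HN => /=.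
  exists (a, n); split=> //= q gq.
  have : `|j x (g x) - j x (map_mx ratr q)| <= ratr a - j x (g x).
    by apply: eP; rewrite (lt_trans gq).
  by rewrite ler_norml; lra.
apply: le_lt_trans ac; apply: le_of_dense => [|e e0]; first exact: jc.
have [|q qe] := @rat_vec_dense _ _ (g x) (Num.min e n.+1%:R^-1).
  by rewrite lt_min e0 invr_gt0 ltr0n.
exists (map_mx ratr q); first by move: qe; rewrite lt_min => /andP[].
by apply: H; move: qe; rewrite lt_min => /andP[].
Qed.

(** The quotients are continuous in the point and in the step, so that rational
    points and steps suffice. *)
Lemma clarke_lt_rat (f : 'rV[R]_k -> R) y h c : locally_lipschitz f ->
  clarke_fine f y h < c <-> exists i : rat * nat, ratr i.1 < c /\
    forall ql : 'rV[rat]_k * rat,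
      `|map_mx ratr ql.1 : 'rV[R]_k| < i.2.+1%:R^-1 /\
      0 < (ratr ql.2 : R) < i.2.+1%:R^-1 ->
      diff_quot f h (y + map_mx ratr ql.1) (ratr ql.2) <= ratr i.1.
Proof.
move=> fL; have fc : continuous f by exact: locally_lipschitz_continuous.
split=> [/rat_in_itvoo[a]|[[a n] /= [ac H]]].
  rewrite in_itv /= => /andP[fa ac].
  have [e e0 eP] := quot_bound_lt fL fa.
  have [n ne] : exists n, n.+1%:R^-1 < e.
    by have [N _ HN] := near_infty_natSinv_lt (PosNum e0); exists N; apply: HN => /=.
  exists (a, n); split=> //= -[q l] /= [qn /andP[l0 ln]].
  apply: eP; last by rewrite l0 (lt_trans ln).
  by rewrite opprD addrA subrr add0r normrN (lt_trans qn).
apply: le_lt_trans ac; apply: quot_bound_le => //.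
pose r : R := n.+1%:R^-1.
have r0 : 0 < r by rewrite invr_gt0.
(* First pass to real points, for rational steps; then to real steps. *)
have Hq (v : 'rV[R]_k) (l : rat) : `|v| < r -> 0 < (ratr l : R) < r ->
    f (y + v + ratr l *: h) - f (y + v) - ratr a * ratr l <= 0.
  move=> vr lr; pose g v := f ((y + ratr l *: h) + v) - f (y + v) - ratr a * ratr l.
  rewrite (addrAC y v) -[leLHS]/(g v); apply: le_of_dense => [|e e0].
    apply: (@continuous_subr _ _ (fun v => f ((y + ratr l *: h) + v) - f (y + v))
      (fun=> ratr a * ratr l)).
      apply: (@continuous_subr _ _ (fun v => f ((y + ratr l *: h) + v))
        (fun v => f (y + v))); exact: continuous_translate.
    exact: cst_continuous.
  have [|q] := @rat_vec_dense _ _ v (Num.min e (r - `|v|)).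
    by rewrite lt_min e0 subr_gt0.
  rewrite lt_min => /andP[qe qr]; exists (map_mx ratr q) => //.
  have := H (q, l); rewrite /= -/r lr /diff_quot ler_pdivrMr; last by case/andP: lr.
  rewrite /g subr_le0 (addrAC y); apply; split=> //.
  have := lerB_dist (map_mx ratr q : 'rV[R]_k) v; rewrite distrC; lra.
exists r => // w l; rewrite -[w in diff_quot _ _ w](subrKC y).
move=> yw /andP[l0 lr]; rewrite ler_pdivrMr//.
set v := w - y; have vr : `|v| < r by rewrite /v distrC.
pose g (l : R) := f (y + v + l *: h) - f (y + v) - ratr a * l.
rewrite -subr_le0 -[leLHS]/(g l); apply: le_of_dense => [|e e0].
  suff gc : continuous g by exact: gc.
  apply: continuous_subr; last exact: mulrl_continuous.
  apply: continuous_subr; first exact: continuous_line.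
  exact: cst_continuous.
have : Num.max 0 (l - e) < Num.min r (l + e).
  by rewrite lt_min !gt_max; apply/andP; split; apply/andP; split; lra.
move=> /rat_in_itvoo[b]; rewrite in_itv /= gt_max lt_min => /andP[/andP[b0 lb] /andP[br bl]].
exists (ratr b); first by rewrite ltr_norml; lra.
by apply: Hq => //; rewrite b0.
Qed.

Hypothesis jL : forall x, D x -> locally_lipschitz (j x).

Lemma measurable_clarke (g h : S -> 'rV[R]_k) :
  measurable_vec g -> measurable_vec h ->
  measurable_fun D (fun x => clarke_fine (j x) (g x) (h x)).
Proof.
move=> mg mh.
apply: (@measurable_fun_countable (rat * nat)%type ('rV[rat]_k * rat)%type
  (fun i c => ratr i.1 < c)
  (fun i ql x => diff_quot (j x) (h x) (g x + map_mx ratr ql.1) (ratr ql.2))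
  (fun i ql => [set x | `|map_mx ratr ql.1 : 'rV[R]_k| < i.2.+1%:R^-1 /\
      0 < (ratr ql.2 : R) < i.2.+1%:R^-1])
  (fun i => ratr i.1)) => [i ql|i [q l]|x c Dx].
- have [H|H] := pselect (`|map_mx ratr ql.1 : 'rV[R]_k| < i.2.+1%:R^-1 /\
      0 < (ratr ql.2 : R) < i.2.+1%:R^-1).
    by rewrite (_ : [set x | _] = setT) ?setIT// -subTset => x _.
  by rewrite (_ : [set x | _] = set0) ?setI0// -subset0 => x.
- have mgq i' : measurable_fun D (fun x => (g x + map_mx ratr q) ord0 i').
    under eq_fun do rewrite mxE.
    by apply: measurable_funD; [exact: mg|exact: measurable_cst].
  rewrite /diff_quot; apply: measurable_funM; last exact: measurable_cst.
  apply: measurable_funB; apply: measurable_superposition => // i'.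
  under eq_fun do rewrite mxE.
  apply: measurable_funD; first exact: mgq.
  under eq_fun do rewrite mxE.
  by apply: measurable_funM; [exact: measurable_cst|exact: mh].
- exact: clarke_lt_rat (jL Dx).
Qed.

End measurable_superposition.

(** * Inequalities for powers and integrals *)

Section powers.
Context (R : realType) (p : R).
Hypothesis p1 : 1 < p.
Implicit Types a b t : R.

Let p0 : 0 <= p. Proof. by rewrite ltW// (lt_trans _ p1). Qed.

Lemma powR_le a b r : 0 <= r -> 0 <= a -> a <= b -> a `^ r <= b `^ r.
Proof.
by move=> r0 a0 ab; apply: ge0_ler_powR; rewrite ?nnegrE// (le_trans a0).
Qed.

Lemma powR_add_le a b : 0 <= a -> 0 <= b ->
  (a + b) `^ p <= 2 `^ p * (a `^ p + b `^ p).
Proof.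
move=> a0 b0.
wlog ab : a b a0 b0 / a <= b => [H|].
  by case: (leP a b) => [|/ltW] /H; [exact|rewrite addrC (addrC (a `^ p)); exact].
apply: (@le_trans _ _ ((2 * b) `^ p)).
  by apply: powR_le => //; [exact: addr_ge0|lra].
by rewrite powRM// ler_wpM2l ?powR_ge0// lerDr powR_ge0.
Qed.

(** Compare both factors with the maximum [m] of [1], [a] and [b]. *)
Lemma powR_growth_le a b : 0 <= a -> 0 <= b ->
  (1 + a `^ (p - 1)) * b <= 2 * (1 + a `^ p + b `^ p).
Proof.
move=> a0 b0; have pp0 : 0 < p by rewrite (lt_trans _ p1).
pose m := Num.max 1 (Num.max a b).
have m1 : 1 <= m by rewrite le_max lexx.
have m0 : 0 <= m by rewrite (le_trans _ m1).
have am : a <= m by rewrite !le_max lexx !orbT.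
have bm : b <= m by rewrite !le_max lexx !orbT.
have mp : m `^ p <= 1 + a `^ p + b `^ p.
  have := powR_ge0 a p; have := powR_ge0 b p.
  have [->|[->|->]] : m = 1 \/ m = a \/ m = b; rewrite ?powR1 /=; try lra.
  rewrite /m; have [_|_] := leP 1 (Num.max a b); last by left.
  by have [_|_] := leP a b; right; [right|left].
have h : (1 + a `^ (p - 1)) * b <= (2 * m `^ (p - 1)) * m.
  have pm0 : 0 <= p - 1 by rewrite subr_ge0 ltW.
  apply: ler_pM => //; first by rewrite addr_ge0 ?powR_ge0.
  have := powR_le pm0 a0 am; have := powR_le pm0 (@ler01 R) m1.
  by rewrite powR1 /=; lra.
apply: (le_trans h); rewrite -mulrA (mulrC _ m) mulr_powRB1// ler_wpM2l//.
Qed.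

Lemma powR_convex a b t : 0 <= a -> 0 <= b -> 0 <= t <= 1 ->
  (t * a + (1 - t) * b) `^ p <= t * a `^ p + (1 - t) * b `^ p.
Proof.
move=> a0 b0 /andP[t0 t1].
have := convex_powR (ltW p1) (Itv01 t0 t1) (x := a) (y := b).
by rewrite !inE /= !in_itv /= !andbT => /(_ a0 b0); rewrite !convRE.
Qed.

End powers.

Section ae_integral.
Context d (S : measurableType d) (R : realType).
Context (mu : {measure set S -> \bar R}) (D : set S).
Hypothesis mD : measurable D.
Implicit Types f g : S -> R.

Lemma integrable_EFinD f g : mu.-integrable D (EFin \o f) ->
  mu.-integrable D (EFin \o g) -> mu.-integrable D (EFin \o (fun x => f x + g x)).
Proof. by move=> intf intg; exact: (integrableD mD intf intg). Qed.

Lemma integrable_EFinZ a f : mu.-integrable D (EFin \o f) ->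
  mu.-integrable D (EFin \o (fun x => a * f x)).
Proof. by move=> intf; exact: (integrableZl mD a intf). Qed.

Lemma EFin_comp_sum (I : finType) (F : I -> S -> R) :
  EFin \o (fun x => \sum_i F i x) = (fun x => \sum_i (F i x)%:E)%E.
Proof. by apply/funext => x /=; rewrite sumEFin. Qed.

Lemma integrable_EFin_sum (I : finType) (F : I -> S -> R) :
  (forall i, mu.-integrable D (EFin \o F i)) ->
  mu.-integrable D (EFin \o (fun x => \sum_i F i x)).
Proof.
move=> intF; rewrite EFin_comp_sum; apply: integrable_sum => // i _.
exact: intF.
Qed.

Lemma Rintegral_sum (I : finType) (F : I -> S -> R) :
  (forall i, mu.-integrable D (EFin \o F i)) ->
  \int[mu]_(x in D) (\sum_i F i x) = \sum_i \int[mu]_(x in D) F i x.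
Proof.
move=> intF; rewrite /Rintegral sum_fine => [|i _]; last first.
  exact: (integrable_fin_num mD (intF i)).
rewrite -(integral_sum mD intF); congr fine.
by apply: eq_integral => x _; rewrite /= sumEFin.
Qed.

Lemma ae_le_integrable f g : measurable_fun D f -> mu.-integrable D (EFin \o g) ->
  {ae mu, forall x, D x -> `|f x| <= g x} -> mu.-integrable D (EFin \o f).
Proof.
move=> mf /integrableP[mg ig] fg; apply/integrableP; split.
  exact/measurable_EFinP.
apply: le_lt_trans ig; apply: ae_ge0_le_integral => //.
- by apply: measurableT_comp => //; exact/measurable_EFinP.
- exact: measurableT_comp.
- apply: filterS fg => x H /H fgx.
  by rewrite /= lee_fin (le_trans fgx)// ler_norm.
Qed.

Lemma integrable_EFin_max f g : mu.-integrable D (EFin \o f) ->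
  mu.-integrable D (EFin \o g) ->
  mu.-integrable D (EFin \o (fun x => Num.max (f x) (g x))).
Proof.
move=> intf intg.
apply: (@ae_le_integrable _ (fun x => `|f x| + `|g x|)) => //.
- by apply: measurable_maxr; apply/measurable_EFinP;
    [exact: measurable_int intf|exact: measurable_int intg].
- exact: integrable_EFinD (integrable_norm intf) (integrable_norm intg).
apply: aeW => x _.
by have [_|_] := leP (f x) (g x); rewrite ?lerDl ?lerDr.
Qed.

(** The function [g] is almost everywhere equal to the maximum of [f] and [g]. *)
Lemma ae_le_Rintegral f g :
  mu.-integrable D (EFin \o f) -> mu.-integrable D (EFin \o g) ->
  {ae mu, forall x, D x -> f x <= g x} ->
  \int[mu]_(x in D) f x <= \int[mu]_(x in D) g x.
Proof.
move=> intf intg fg; have intm := integrable_EFin_max intf intg.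
rewrite (_ : \int[mu]_(x in D) g x = \int[mu]_(x in D) Num.max (f x) (g x)).
  by apply: le_Rintegral => // x _; rewrite le_max lexx.
congr fine; apply: ae_eq_integral => //.
- exact: measurable_int intg.
- exact: measurable_int intm.
by apply: filterS fg => x H Dx; rewrite max_r// H.
Qed.

Lemma EFin_Rintegral f : mu.-integrable D (EFin \o f) ->
  (\int[mu]_(x in D) (f x)%:E)%E = (\int[mu]_(x in D) f x)%:E.
Proof. by move=> intf; rewrite /Rintegral fineK//; exact: integrable_fin_num. Qed.

End ae_integral.

(** * The modular of an L^p space *)

Section modular.
Context d (S : measurableType d) (R : realType) (k : nat).
Context (mu : {measure set S -> \bar R}) (D : set S) (p : R).
Hypothesis mD : measurable D.
Hypothesis p1 : 1 < p.
Implicit Types f g h : S -> 'rV[R]_k.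

Let p0 : 0 < p. Proof. exact: lt_trans p1. Qed.

Lemma measurable_vecD f g : measurable_vec D f -> measurable_vec D g ->
  measurable_vec D (fun x => f x + g x).
Proof.
move=> mf mg i; under eq_fun do rewrite mxE.
by apply: measurable_funD; [exact: mf|exact: mg].
Qed.

Lemma measurable_vecZ a f : measurable_vec D f ->
  measurable_vec D (fun x => a *: f x).
Proof.
move=> mf i; under eq_fun do rewrite mxE.
by apply: measurable_funM; [exact: measurable_cst|exact: mf].
Qed.

Lemma measurable_vec_norm f : measurable_vec D f ->
  measurable_fun D (fun x => `|f x|).
Proof.
move=> mf; apply: measurable_fun_lt => // c.
have [c0|c0] := ltP 0 c.
  by have := measurable_dist_lt mD 0 c0 mf; under eq_set do rewrite subr0.
rewrite (_ : [set x | _] = set0) ?setI0// -subset0 => x /=.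
by apply/negP; rewrite -leNgt (le_trans c0).
Qed.

Lemma measurable_vec_powR f : measurable_vec D f ->
  measurable_fun D (fun x => `|f x| `^ p).
Proof.
move=> /measurable_vec_norm mf.
exact: (measurableT_comp (measurable_powR p) mf).
Qed.

(** The [p]-th power of the L^p norm, for the sup norm on R^k. It spares Minkowski's
    inequality: being convex, and subadditive up to the factor [2 `^ p], is enough
    for the topological arguments below. *)
Definition modular f : R := \int[mu]_(x in D) (`|f x| `^ p).

Definition modular_space : set (S -> 'rV[R]_k) := [set f |
  measurable_vec D f /\ mu.-integrable D (EFin \o (fun x => `|f x| `^ p))].

Lemma modular_spaceZ a f : modular_space f -> modular_space (fun x => a *: f x).
Proof.
move=> [mf intf]; split; first exact: measurable_vecZ.
under [X in EFin \o X]eq_fun do rewrite normrZ powRM//.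
exact: (integrable_EFinZ mD (`|a| `^ p) intf).
Qed.

Lemma modularZ a f : modular_space f ->
  modular (fun x => a *: f x) = `|a| `^ p * modular f.
Proof.
move=> [mf intf]; rewrite /modular.
under eq_Rintegral do rewrite normrZ powRM//.
exact: RintegralZl.
Qed.

Lemma modular_spaceD f g : modular_space f -> modular_space g ->
  modular_space (fun x => f x + g x).
Proof.
move=> [mf intf] [mg intg]; have mfg := measurable_vecD mf mg; split=> //.
apply: (@ae_le_integrable _ _ _ _ _ mD _
  (fun x => 2 `^ p * (`|f x| `^ p + `|g x| `^ p))).
- exact: measurable_vec_powR.
- exact: (integrable_EFinZ mD (2 `^ p) (integrable_EFinD mD intf intg)).
apply: aeW => x _; rewrite ger0_norm ?powR_ge0//.
apply: le_trans (powR_add_le p1 _ _) => //.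
by apply: powR_le => //; [exact: ltW|exact: ler_normD].
Qed.

Lemma modularD f g : modular_space f -> modular_space g ->
  modular (fun x => f x + g x) <= 2 `^ p * (modular f + modular g).
Proof.
move=> fS gS; have [_ intfg] := modular_spaceD fS gS.
have [mf intf] := fS; have [mg intg] := gS.
rewrite /modular -RintegralD// -RintegralZl//; last exact: integrable_EFinD.
apply: le_Rintegral => //.
  exact: (integrable_EFinZ mD (2 `^ p) (integrable_EFinD mD intf intg)).
move=> x _; apply: le_trans (powR_add_le p1 _ _) => //.
by apply: powR_le => //; [exact: ltW|exact: ler_normD].
Qed.

Lemma modular_spaceB f g : modular_space f -> modular_space g ->
  modular_space (fun x => f x - g x).
Proof.
move=> fS /(modular_spaceZ (-1)) /(modular_spaceD fS).
by under eq_fun do rewrite scaleN1r.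
Qed.

Lemma modular_ae_eq f g : modular_space f -> modular_space g ->
  {ae mu, forall x, D x -> f x = g x} -> modular f = modular g.
Proof.
move=> [mf intf] [mg intg] fg; apply/le_anti/andP; split;
  apply: ae_le_Rintegral => //; by apply: filterS fg => x H /H ->.
Qed.

Lemma modular_convex f g t : modular_space f -> modular_space g -> 0 <= t <= 1 ->
  modular (fun x => t *: f x + (1 - t) *: g x) <=
  t * modular f + (1 - t) * modular g.
Proof.
move=> fS gS t01.
have [_ intfg] := modular_spaceD (modular_spaceZ t fS) (modular_spaceZ (1 - t) gS).
have [mf intf] := fS; have [mg intg] := gS.
have ia := integrable_EFinZ mD t intf; have ib := integrable_EFinZ mD (1 - t) intg.
rewrite /modular -!RintegralZl// -RintegralD//.
apply: le_Rintegral => //; first exact: integrable_EFinD.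
move=> x _; apply: le_trans (powR_convex p1 _ _ t01) => //.
apply: powR_le => //; first exact: ltW.
by case/andP: t01 => t0 t1; rewrite (le_trans (ler_normD _ _))// !normrZ !ger0_norm ?subr_ge0.
Qed.

End modular.

(** * Integrals of Clarke derivatives *)

Lemma domination_le (R : realType) (c q a b h r s : R) : 0 <= c ->
  r <= q * (a + h) -> s <= q * (b + h) ->
  c * (1 + r + s) <= c * (1 + q * (a + b) + 2 * q * h).
Proof. by move=> c0 rle sle; apply: ler_wpM2l => //; lra. Qed.

Lemma le_domination (R : realType) (q a h : R) : 1 <= q -> 0 <= a -> 0 <= h ->
  a <= q * (a + h).
Proof.
move=> q1 a0 h0; apply: (@le_trans _ _ (1 * (a + h))); first by rewrite mul1r lerDl.
by apply: ler_wpM2r => //; exact: addr_ge0.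
Qed.

Section clarke_integral.
Context d (S : measurableType d) (R : realType) (k : nat).
Context (mu : {measure set S -> \bar R}) (D : set S) (p K : R).
Context (j : S -> 'rV[R]_k -> R).
Hypothesis mD : measurable D.
Hypothesis finD : (mu D < +oo)%E.
Hypothesis p1 : 1 < p.
Hypothesis mj : forall y, measurable_fun D (fun x => j x y).
Hypothesis jL : forall x, D x -> locally_lipschitz (j x).
Hypothesis K0 : 0 <= K.
Hypothesis jK : {ae mu, forall x, D x -> forall y h,
  `|clarke_fine (j x) y h| <= K * ((1 + `|y| `^ (p - 1)) * `|h|)}.
Implicit Types f g h : S -> 'rV[R]_k.

Local Notation LpV := (modular_space mu D p).
Local Notation mdl := (modular mu D p).

Definition clarke_integral f h : R :=
  \int[mu]_(x in D) clarke_fine (j x) (f x) (h x).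

Lemma integrable_const_fun (c : R) : mu.-integrable D (EFin \o (fun=> c)).
Proof.
apply/integrableP; split; first exact: measurable_cst.
rewrite [ltLHS](_ : _ = (`|c|%:E * mu D)%E); last by rewrite -integral_cst.
by rewrite lte_mul_pinfty.
Qed.

Lemma ae_clarke_bound : {ae mu, forall x, D x -> forall y v : 'rV[R]_k,
  `|clarke_fine (j x) y v| <= 2 * K * (1 + `|y| `^ p + `|v| `^ p)}.
Proof.
apply: filterS jK => x H Dx y v; apply: (le_trans (H Dx y v)).
by rewrite (mulrC 2) -mulrA ler_wpM2l// powR_growth_le.
Qed.

Lemma clarke_integrand_measurable f h : LpV f -> LpV h ->
  measurable_fun D (fun x => clarke_fine (j x) (f x) (h x)).
Proof.
move=> [mf _] [mh _]; apply: measurable_clarke => //.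
by move=> x Dx; apply: locally_lipschitz_continuous; exact: jL.
Qed.

Lemma clarke_integrable f h : LpV f -> LpV h ->
  mu.-integrable D (EFin \o (fun x => clarke_fine (j x) (f x) (h x))).
Proof.
move=> fS hS; have [mf intf] := fS; have [mh inth] := hS.
apply: (@ae_le_integrable _ _ _ _ _ mD _
  (fun x => 2 * K * (1 + `|f x| `^ p + `|h x| `^ p))).
- exact: clarke_integrand_measurable.
- apply: integrable_EFinZ => //; apply: integrable_EFinD => //.
  by apply: integrable_EFinD => //; exact: integrable_const_fun.
by apply: filterS ae_clarke_bound => x H Dx; exact: H.
Qed.

Lemma clarke_integral_scale f h h' (t : R) : LpV f -> LpV h -> LpV h' -> 0 < t ->
  {ae mu, forall x, D x -> h' x = t *: h x} ->
  clarke_integral f h' <= t * clarke_integral f h.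
Proof.
move=> fS hS h'S t0 hh'; rewrite /clarke_integral -RintegralZl//; last first.
  exact: clarke_integrable.
apply: ae_le_Rintegral => //; first exact: clarke_integrable.
  by apply: integrable_EFinZ => //; exact: clarke_integrable.
apply: filterS hh' => x H Dx; rewrite H//.
by have [_] := clarke_sublinear (jL Dx) (f x); exact.
Qed.

(** Clarke's derivative is sublinear in the direction and vanishes in the zero
    direction. *)
Lemma clarke_integral_combination (m : nat) (l : 'I_m -> R)
    (h : 'I_m -> S -> 'rV[R]_k) f : LpV f -> (forall i, LpV (h i)) ->
  (forall i, 0 <= l i) ->
  {ae mu, forall x, D x -> \sum_i l i *: h i x = 0} ->
  0 <= \sum_i l i * clarke_integral f (h i).
Proof.
move=> fS hS l0 h0.
have int i : mu.-integrable D
    (EFin \o (fun x => l i * clarke_fine (j x) (f x) (h i x))).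
  by apply: integrable_EFinZ => //; exact: clarke_integrable.
have -> : \sum_i l i * clarke_integral f (h i) =
    \int[mu]_(x in D) \sum_i l i * clarke_fine (j x) (f x) (h i x).
  rewrite Rintegral_sum//; apply: eq_bigr => i _.
  by rewrite RintegralZl//; exact: clarke_integrable.
rewrite [leLHS](_ : _ = \int[mu]_(x in D) (0 : R)); last by rewrite Rintegral_cst// mul0r.
apply: ae_le_Rintegral => //.
- exact: integrable_const_fun.
- exact: (integrable_EFin_sum mD int).
apply: filterS h0 => x H Dx; have cS := clarke_sublinear (jL Dx) (f x).
rewrite -[leLHS](sublinear0 cS) -[in leLHS](H Dx).
elim/big_ind2: _ => [|a b u v ab uv|i _]; first by rewrite (sublinear0 cS).
  by rewrite (le_trans (cS.1 _ _))// lerD.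
have := l0 i; rewrite le_eqVlt => /predU1P[<-|li]; last exact: cS.2.
by rewrite scale0r mul0r (sublinear0 cS).
Qed.

(** Otherwise there are functions [F n] with integrals above [c] that approach [f] so
    fast that the sum [H] of all the [|F n - f| `^ p] is integrable. Then [F n]
    tends to [f] almost everywhere, and the growth condition bounds all the
    integrands by one integrable function [B] of [f], [g] and [H]. The upper
    semicontinuity of Clarke's derivative makes the maximum [M n] of the [n]-th
    integrand and the limit integrand [G] tend to [G], so that dominated
    convergence shows that the integral of [G] is at least [c]. *)
Lemma clarke_integral_usc f g c : LpV f -> LpV g ->
  clarke_integral f (fun x => g x - f x) < c ->
  exists2 e : R, 0 < e & forall f', LpV f' -> mdl (fun x => f' x - f x) <= e ->
    clarke_integral f' (fun x => g x - f' x) <= c.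
Proof.
move=> fS gS fc; apply: contrapT => nex.
have /choice[F FP] (n : nat) : exists f', [/\ LpV f',
    mdl (fun x => f' x - f x) <= 1 / (2 ^ n.+1)%:R &
    c < clarke_integral f' (fun x => g x - f' x)].
  apply: contrapT => nf; apply: nex; exists (1 / (2 ^ n.+1)%:R) => [|f' f'S f'f].
    by rewrite divr_gt0// ltr0n expn_gt0.
  by rewrite leNgt; apply/negP => cf'; apply: nf; exists f'.
pose w n x := `|F n x - f x| `^ p.
have w0 n x : 0 <= w n x by exact: powR_ge0.
have FS n : LpV (F n) by case: (FP n).
have FfS n : LpV (fun x => F n x - f x) := modular_spaceB mD p1 (FS n) fS.
have gFS n : LpV (fun x => g x - F n x) := modular_spaceB mD p1 gS (FS n).
have gfS : LpV (fun x => g x - f x) := modular_spaceB mD p1 gS fS.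
pose H x : \bar R := (\sum_(n <oo) (w n x)%:E)%E.
have mw n : measurable_fun D (fun x => (w n x)%:E).
  by apply/measurable_EFinP; apply: measurable_vec_powR => //; case: (FfS n).
have H0 x : (0 <= H x)%E by apply: nneseries_ge0 => n _ _; rewrite lee_fin.
have mH : measurable_fun D H by apply: ge0_emeasurable_sum => // n x _ _; rewrite lee_fin.
have intH : mu.-integrable D H.
  apply/integrableP; split=> //.
  under eq_integral do rewrite gee0_abs//.
  rewrite integral_nneseries//; last by move=> n x _; rewrite lee_fin.
  apply: (@le_lt_trans _ _ (\sum_(n <oo) (1 / (2 ^ n.+1)%:R)%:E)%E).
    apply: lee_nneseries => [n _ _|n _].
      by apply: integral_ge0 => x _; rewrite lee_fin.
    have [_ wn _] := FP n.
    rewrite -[leLHS]fineK ?lee_fin//.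
    by apply: integrable_fin_num => //; case: (FfS n).
  by apply: le_lt_trans (epsilon_trick0 xpredT _) _ => //; rewrite ltry.
pose G x := clarke_fine (j x) (f x) (g x - f x).
pose Gn n x := clarke_fine (j x) (F n x) (g x - F n x).
pose M n x := Num.max (Gn n x) (G x).
pose B x : \bar R := ((2 * K * (1 + 2 `^ p * (`|f x| `^ p + `|g x - f x| `^ p)))%:E
  + (2 * K * (2 * 2 `^ p))%:E * H x)%E.
have mG : measurable_fun D G := clarke_integrand_measurable fS gfS.
have mGn n : measurable_fun D (Gn n) :=
  clarke_integrand_measurable (FS n) (gFS n).
have mM n : measurable_fun D (M n) := measurable_maxr (mGn n) mG.
have intG : mu.-integrable D (EFin \o G) := clarke_integrable fS gfS.
have intGn n : mu.-integrable D (EFin \o Gn n) := clarke_integrable (FS n) (gFS n).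
have intB : mu.-integrable D B.
  apply: integrableD => //; last exact: integrableZl.
  apply: integrable_EFinZ => //; apply: integrable_EFinD => //.
    exact: integrable_const_fun.
  apply: integrable_EFinZ => //; apply: integrable_EFinD => //.
    by case: fS.
  by case: gfS.
have aeH := integrable_ae mD intH.
have cvM : {ae mu, forall x, D x -> (M n x)%:E @[n --> \oo] --> (G x)%:E}.
  apply: filterS aeH => x Hfin Dx; have {}Hfin := Hfin Dx.
  have w_cvg0 : w n x @[n --> \oo] --> (0 : R).
    apply: cvg_series_cvg_0; apply: nnseries_is_cvg => //.
    by rewrite -/(H x) -ge0_fin_numE.
  apply/fine_cvgP; split; first exact: nearW.
  apply/cvgrPdist_le => e e0 /=.
  have [|a a0 Ha] := @clarke_usc _ _ _ (jL Dx) (f x) (g x - f x) (G x + e).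
    by rewrite -/(G x) ltrDl.
  have ap : 0 < a `^ p by exact: powR_gt0.
  have /cvgrPdist_lt/(_ _ ap) := w_cvg0.
  apply: filterS => n /=; rewrite sub0r normrN ger0_norm// => wa.
  have Ffa : `|F n x - f x| < a.
    rewrite ltNge; apply/negP => aF; move: wa; rewrite ltNge => /negP; apply.
    by apply: powR_le => //; rewrite ltW// (lt_trans _ p1).
  have : Gn n x <= G x + e.
    apply: Ha; first by rewrite distrC.
    by rewrite opprB addrC addrA subrK.
  rewrite ler_norml /M => Gle.
  by have [?|?] := leP (Gn n x) (G x); lra.
have bM : {ae mu, forall x n, D x -> (`|(M n x)%:E| <= B x)%E}.
  apply: filterS2 aeH ae_clarke_bound => x Hfin Hb n Dx.
  have {}Hfin := Hfin Dx; have {}Hb := Hb Dx.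
  have wH : w n x <= fine (H x).
    rewrite -lee_fin fineK//.
    have /= := @nneseries_lim_ge R (fun n => (w n x)%:E) xpredT 0%N n.+1.
    move=> /(_ (fun i _ _ => _)) wH; apply: le_trans (wH _) => [|i].
      rewrite big_nat_recr//= leeDr// sume_ge0// => i _; rewrite lee_fin//.
    by rewrite lee_fin.
  rewrite /B -[H x]fineK// -EFinM -EFinD lee_fin.
  set hx := fine (H x) in wH *.
  have p2 : 1 <= 2 `^ p :> R.
    by rewrite -[leLHS](powRr0 2) ler_powR ?ler1n// ltW// (lt_trans _ p1).
  have pfw : `|F n x| `^ p <= 2 `^ p * (`|f x| `^ p + hx).
    rewrite -[F n x](subrK (f x)) addrC.
    apply: (@le_trans _ _ ((`|f x| + `|F n x - f x|) `^ p)).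
      by apply: powR_le; [rewrite ltW// (lt_trans _ p1)|by []|exact: ler_normD].
    rewrite (le_trans (powR_add_le p1 _ _))// ler_wpM2l ?powR_ge0//.
    by rewrite lerD2l.
  have pgw : `|g x - F n x| `^ p <= 2 `^ p * (`|g x - f x| `^ p + hx).
    have -> : g x - F n x = (g x - f x) + (f x - F n x) by rewrite addrA subrK.
    apply: (@le_trans _ _ ((`|g x - f x| + `|f x - F n x|) `^ p)).
      by apply: powR_le; [rewrite ltW// (lt_trans _ p1)|by []|exact: ler_normD].
    rewrite (le_trans (powR_add_le p1 _ _))// ler_wpM2l ?powR_ge0//.
    by rewrite lerD2l distrC.
  have hx0 : 0 <= hx by rewrite (le_trans _ wH).
  have f0 := powR_ge0 `|f x| p; have g0 := powR_ge0 `|g x - f x| p.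
  have K20 : 0 <= 2 * K by rewrite mulr_ge0.
  rewrite -(mulrA (2 * K) (2 * 2 `^ p) hx) -(mulrDr (2 * K)).
  have bG := le_trans (Hb (f x) (g x - f x))
    (domination_le K20 (le_domination p2 f0 hx0) (le_domination p2 g0 hx0)).
  have bGn := le_trans (Hb (F n x) (g x - F n x)) (domination_le K20 pfw pgw).
  by rewrite /M; have [_|_] := leP (Gn n x) (G x); [exact: bG|exact: bGn].
have mE (u : S -> R) : measurable_fun D u -> measurable_fun D (EFin \o u).
  by move=> ?; exact/measurable_EFinP.
have [_ _ cvI] := dominated_convergence mD (fun n => mE _ (mM n)) (mE _ mG) cvM intB bM.
have : (c%:E <= \int[mu]_(x in D) (G x)%:E)%E.
  rewrite -(cvg_lim _ cvI)//; apply: lime_ge; first by apply: cvgP cvI.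
  apply: nearW => n /=; have [_ _ /ltW cn] := FP n.
  rewrite (EFin_Rintegral mD (integrable_EFin_max mD (intGn n) intG)) lee_fin.
  apply: (le_trans cn).
  apply: (le_Rintegral mD (intGn n) (integrable_EFin_max mD (intGn n) intG)) => x _.
  by rewrite le_max lexx.
by rewrite (EFin_Rintegral mD intG) lee_fin leNgt => /negP; apply.
Qed.

End clarke_integral.

(** * Compact operators into an L^p space *)

Lemma mxnorm_le_enorm (R : realType) (k : nat) (y : 'rV[R]_k) : `|y| <= enorm y.
Proof. by apply: mxnorm_le => [|i]; [exact: sqrtr_ge0|exact: enorm_ge]. Qed.

Lemma enorm_le_mxnorm (R : realType) (k : nat) (y : 'rV[R]_k) :
  enorm y <= k%:R * `|y|.
Proof.
have [k0|k0] := leqP k 0.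
  rewrite /enorm /edot big1 ?sqrtr0 ?mulr_ge0// => i _.
  by exfalso; have := leq_trans (ltn_ord i) k0.
have k1 : 1 <= k%:R :> R by rewrite ler1n.
rewrite -[leRHS]ger0_norm ?mulr_ge0// -sqrtr_sqr ler_sqrt ?sqr_ge0//.
apply: (@le_trans _ _ (\sum_(i < k) `|y| ^+ 2)).
  apply: ler_sum => i _; rewrite -expr2 -real_normK ?num_real//.
  by rewrite ler_sqr ?nnegrE// ler_mxnorm.
rewrite sumr_const card_ord -[leLHS]mulr_natl exprMn ler_wpM2r ?sqr_ge0//.
by rewrite expr2 ler_peMl.
Qed.

Lemma powR_invK (R : realType) (p a : R) : p != 0 -> 0 <= a ->
  (a `^ p^-1) `^ p = a.
Proof. by move=> pn a0; rewrite -powRrM mulVf// powRr1. Qed.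

Section Lp_modular.
Context (R : realType) (N k : nat) (Omega : set (lebesgue_rV_type R N)) (p : R).
Local Notation mu := (lebesgue_rV R N).
Hypothesis mO : measurable Omega.
Hypothesis p1 : 1 < p.
Implicit Types f g : lebesgue_rV_type R N -> 'rV[R]_k.

Let p0 : 0 < p. Proof. exact: lt_trans p1. Qed.

Let energy f := (\int[mu]_(x in Omega) (enorm (f x) `^ p)%:E)%E.

Lemma Lp_normE f : Lp_norm Omega p f = (energy f `^ p^-1)%E.
Proof.
rewrite /Lp_norm unlock /energy [in RHS]integral_mkcond; congr poweR.
apply: eq_integral => x _; rewrite !patchE; case: ifPn => _ /=.
  by rewrite ger0_norm// sqrtr_ge0.
by rewrite normr0 powR0// gt_eqF.
Qed.

Lemma measurable_enorm f : measurable_vec Omega f ->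
  measurable_fun Omega (fun x => enorm (f x)).
Proof.
move=> mf; apply: (measurableT_comp (f := @Num.sqrt R)).
  by apply: continuous_measurable_fun => x; exact: sqrt_continuous.
by apply: measurable_sum => i; apply: measurable_funM; exact: mf.
Qed.

Lemma integral_norm_le_energy f : measurable_vec Omega f ->
  (\int[mu]_(x in Omega) (`|f x| `^ p)%:E <= energy f)%E.
Proof.
move=> mf; apply: (ge0_le_integral mu mO).
- by move=> x _; rewrite lee_fin powR_ge0.
- by apply/measurable_EFinP; exact: measurable_vec_powR.
- apply/measurable_EFinP; apply: (measurableT_comp (measurable_powR p)).
  exact: measurable_enorm.
- move=> x _; rewrite lee_fin; apply: powR_le; rewrite ?(ltW p0)//.
  exact: mxnorm_le_enorm.
Qed.

Lemma energy_ge0 f : (0 <= energy f)%E.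
Proof. by apply: integral_ge0 => x _; rewrite lee_fin powR_ge0. Qed.

Lemma in_Lp_modular_space f : in_Lp Omega p f -> modular_space mu Omega p f.
Proof.
move=> [mf]; rewrite Lp_normE => fp; split=> //.
apply/integrableP; split; first by apply/measurable_EFinP; exact: measurable_vec_powR.
under eq_integral => x _ do rewrite gee0_abs ?lee_fin ?powR_ge0//.
apply: le_lt_trans (integral_norm_le_energy mf) _.
rewrite ltey; apply/eqP => E; move: fp; rewrite E.
by rewrite poweRyr ?invr_eq0 ?gt_eqF.
Qed.

Lemma modular_le_Lp_norm f (e : R) : modular_space mu Omega p f -> 0 <= e ->
  (Lp_norm Omega p f <= e%:E)%E -> modular mu Omega p f <= e `^ p.
Proof.
move=> [mf intf] e0; rewrite Lp_normE => fe.
rewrite -lee_fin -(EFin_Rintegral mO intf).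
apply: le_trans (integral_norm_le_energy mf) _.
have := energy_ge0 f; case: (energy f) fe => [r||]//.
  rewrite !lee_fin => re r0.
  rewrite -[r](@powR_invK _ p) ?gt_eqF//; apply: powR_le => //; first exact: ltW.
  exact: powR_ge0.
by rewrite poweRyr ?invr_eq0 ?gt_eqF.
Qed.

End Lp_modular.

Section compact_operator.
Context d (S : measurableType d) (R : realType) (k : nat).
Context (mu : {measure set S -> \bar R}) (D : set S) (p : R).
Context (X : normedModType R) (T : X -> S -> 'rV[R]_k).
Hypothesis mD : measurable D.
Hypothesis p1 : 1 < p.
Local Notation LpV := (modular_space mu D p).
Local Notation mdl := (modular mu D p).
Hypothesis TS : forall u, LpV (T u).
Hypothesis Tlin : forall (a : R) (u v : X),
  {ae mu, forall x, D x -> T (a *: u + v) x = a *: T u x + T v x}.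
Hypothesis Tcpt : forall u_ : nat -> X, bounded_set (range u_) ->
  exists (s : nat -> nat) f, [/\ {homo s : m n / (m < n)%N}, LpV f &
    forall e : R, 0 < e -> \forall n \near \oo, mdl (fun x => T (u_ (s n)) x - f x) <= e].

Let p0 : 0 < p. Proof. exact: lt_trans p1. Qed.

(** The value [T u] is only determined almost everywhere, so that the algebra of [T]
    is available for this quantity rather than for the functions themselves. *)
Definition operator_gap u v := mdl (fun x => T u x - T v x).

Let TB u v : LpV (fun x => T u x - T v x).
Proof. exact: modular_spaceB. Qed.

Lemma modular_triangle (f g h : S -> 'rV[R]_k) : LpV f -> LpV g -> LpV h ->
  mdl (fun x => f x - h x) <=
  2 `^ p * (mdl (fun x => f x - g x) + mdl (fun x => g x - h x)).
Proof.
move=> fS gS hS.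
have -> : (fun x => f x - h x) = (fun x => (f x - g x) + (g x - h x)).
  by apply/funext => x; rewrite addrA subrK.
exact: (modularD mD p1 (modular_spaceB mD p1 fS gS) (modular_spaceB mD p1 gS hS)).
Qed.

Lemma modular_distC (f g : S -> 'rV[R]_k) : mdl (fun x => f x - g x) = mdl (fun x => g x - f x).
Proof. by apply: eq_Rintegral => x _; rewrite distrC. Qed.

Lemma operator_ae0 : {ae mu, forall x, D x -> T 0 x = 0}.
Proof.
have := Tlin 1 0 0; rewrite scaler0 addr0; apply: filterS => x H /H.
by rewrite scale1r => /eqP; rewrite -subr_eq0 opprD addrA subrr sub0r oppr_eq0 => /eqP.
Qed.

Lemma operator_aeZ a u : {ae mu, forall x, D x -> T (a *: u) x = a *: T u x}.
Proof.
have := Tlin a u 0; rewrite addr0; apply: filterS2 operator_ae0 => x T0 H Dx.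
by rewrite H// T0// addr0.
Qed.

Lemma operator_aeB u v : {ae mu, forall x, D x -> T (u - v) x = T u x - T v x}.
Proof.
have := Tlin (-1) v u; rewrite scaleN1r addrC; apply: filterS => x H Dx.
by rewrite H// scaleN1r addrC.
Qed.

Lemma operator_ae_sum (m : nat) (l : 'I_m -> R) (v : 'I_m -> X) :
  {ae mu, forall x, D x -> T (\sum_i l i *: v i) x = \sum_i l i *: T (v i) x}.
Proof.
elim: (index_enum _) => [|i s IH].
  by apply: filterS operator_ae0 => x H Dx; rewrite !big_nil H.
have := Tlin (l i) (v i) (\sum_(i <- s) l i *: v i).
by apply: filterS2 IH => x IH H Dx; rewrite !big_cons H// IH.
Qed.

(** Otherwise points of the unit ball have images whose modulars exceed all natural
    numbers, against the convergence of a subsequence of these images. *)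
Lemma operator_bounded : exists2 M, 0 <= M & forall u, `|u| <= 1 -> mdl (T u) <= M.
Proof.
apply: contrapT => nb.
have /choice[u_ uP] (n : nat) : exists u, `|u| <= 1 /\ n%:R < mdl (T u).
  apply: contrapT => nu; apply: nb; exists n%:R => // u u1.
  by rewrite leNgt; apply/negP => nTu; apply: nu; exists u.
have [|s [f [sS fS sf]]] := @Tcpt u_.
  exists 1; split=> // M M1 _ [n _ <-]; exact: le_trans (uP n).1 (ltW M1).
have [n0 _ Hn] := sf 1 ltr01.
have sn n : (n <= s n)%N.
  by elim: n => // n IH; apply: leq_ltn_trans IH (sS _ _ _).
pose B := 2 `^ p * (1 + mdl f).
have [n1 Bn1] : exists n : nat, B < n%:R.
  by exists (Num.truncn B).+1; exact: truncnS_gt.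
pose n := maxn n0 n1.
have := Hn n (leq_maxl _ _) => /= H.
have [_] := uP (s n); apply/negP; rewrite -leNgt.
apply: (@le_trans _ _ B).
  have := modularD mD p1 (modular_spaceB mD p1 (TS (u_ (s n))) fS) fS.
  under [fun x => _ + _]eq_fun do rewrite subrK.
  by move=> /le_trans; apply; rewrite ler_wpM2l ?powR_ge0// lerD2r.
rewrite (le_trans (ltW Bn1))// ler_nat (leq_trans _ (sn n))//.
exact: leq_maxr.
Qed.

(** The bound on the unit ball extends by homogeneity. *)
Lemma operator_gap_le : exists2 M, 0 <= M &
  forall u v, operator_gap u v <= M * `|u - v| `^ p.
Proof.
have [M M0 HM] := operator_bounded; exists M => // u v.
have -> : operator_gap u v = mdl (T (u - v)).
  apply: modular_ae_eq => //; apply: filterS (operator_aeB u v) => x H Dx.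
  by rewrite H.
set w := u - v; have [->|w0] := eqVneq w 0.
  rewrite normr0 powR0 ?gt_eqF// mulr0.
  suff -> : mdl (T 0) = mdl (fun x => 0 *: T 0 x).
    by rewrite modularZ// normr0 powR0 ?gt_eqF// mul0r.
  apply: modular_ae_eq => //; first exact: modular_spaceZ.
  by apply: filterS operator_ae0 => x H Dx; rewrite H// scaler0.
have nw : 0 < `|w| by rewrite normr_gt0.
have -> : mdl (T w) = mdl (fun x => `|w| *: T (`|w|^-1 *: w) x).
  apply: modular_ae_eq => //; first exact: modular_spaceZ.
  apply: filterS (operator_aeZ `|w| (`|w|^-1 *: w)) => x H Dx.
  by rewrite -H// scalerA divff ?gt_eqF// scale1r.
rewrite modularZ// normr_id mulrC ler_wpM2r ?powR_ge0// HM//.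
by rewrite normrZ normfV normr_id mulVf ?gt_eqF.
Qed.

Lemma operator_continuous u (e : R) : 0 < e -> exists2 r : R, 0 < r &
  forall u', `|u - u'| < r -> operator_gap u' u <= e.
Proof.
move=> e0; have [M M0 HM] := operator_gap_le.
have M1 : 0 < M + 1 by rewrite ltr_wpDl.
exists ((e / (M + 1)) `^ p^-1); first by rewrite powR_gt0// divr_gt0.
move=> u' uu'; apply: (le_trans (HM _ _)).
have h : `|u' - u| `^ p <= e / (M + 1).
  rewrite -[leRHS](@powR_invK _ p) ?gt_eqF//; last exact: ltW (divr_gt0 e0 M1).
  by apply: powR_le; rewrite ?(ltW p0)// distrC ltW.
have : `|u' - u| `^ p * (M + 1) <= e by rewrite -ler_pdivlMr.
by have := powR_ge0 `|u' - u| p; rewrite mulrDr mulr1 mulrC; lra.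
Qed.

Lemma operator_ball_convex u0 (e : R) :
  convex_set [set w | operator_gap w u0 <= e].
Proof.
apply/convex_setP => v w t /= ve we t01.
have -> : operator_gap (t *: v + (1 - t) *: w) u0 =
    mdl (fun x => t *: (T v x - T u0 x) + (1 - t) *: (T w x - T u0 x)).
  apply: modular_ae_eq => //.
    by apply: modular_spaceD => //; apply: modular_spaceZ.
  apply: filterS2 (Tlin t v ((1 - t) *: w)) (operator_aeZ (1 - t) w) => x H1 H2 Dx.
  rewrite H1// H2// !scalerBr addrACA -opprD -scalerDl.
  by rewrite (addrC t) subrK scale1r.
apply: le_trans (modular_convex mD p1 (TB v u0) (TB w u0) t01) _.
have /andP[t0 t1] := t01.
have h1 : t * operator_gap v u0 <= t * e := ler_wpM2l t0 ve.
have h2 : (1 - t) * operator_gap w u0 <= (1 - t) * e.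
  by apply: ler_wpM2l we; rewrite subr_ge0.
by apply: le_trans (lerD h1 h2) _; rewrite -mulrDl (addrC t) subrK mul1r.
Qed.

(** Otherwise one can choose points of [K] one after the other, each of them far
    from all the previous ones, and their images have no convergent subsequence. *)
Lemma operator_totally_bounded (K : set X) (F : set_system X) (e : R) :
  bounded_set K -> UltraFilter F -> F K -> 0 < e ->
  exists2 w0, K w0 & F [set w | operator_gap w w0 <= e].
Proof.
move=> Kb FU FK e0; apply: contrapT => nw.
have far w0 : K w0 -> F [set w | e < operator_gap w w0].
  move=> Kw0; have [H|] := in_ultra_setVsetC [set w | operator_gap w w0 <= e] FU.
    by exfalso; apply: nw; exists w0.
  by apply: filterS => w /= /negP; rewrite -ltNge.
have /choice[g gP] (s : seq X) : exists w, K w /\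
    forall w0, w0 \in s -> K w0 -> e < operator_gap w w0.
  have : F [set w | K w /\ forall w0, w0 \in s -> K w0 -> e < operator_gap w w0].
    elim: s => [|a s IH]; first by apply: filterS FK => w Kw; split.
    have [Ka|Ka] := pselect (K a).
      apply: filterS (filterI IH (far a Ka)) => w [[Kw H] wa].
      split=> [|w0]; first exact: Kw.
      by rewrite inE => /predU1P[-> _|w0s]; [exact: wa|exact: H w0s].
    apply: filterS IH => w [Kw H]; split=> [|w0]; first exact: Kw.
    by rewrite inE => /predU1P[->|w0s]; [move=> /Ka|exact: H w0s].
  by move=> /filter_ex.
(* [st n] lists the [n] points chosen so far. *)
pose st := fix st n := if n is n'.+1 then g (st n') :: st n' else [::].
pose u_ n := g (st n).
have uK n : K (u_ n) by have [] := gP (st n).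
have st_mem m n : (m < n)%N -> u_ m \in st n.
  elim: n => // n IH; rewrite ltnS leq_eqVlt => /predU1P[->|/IH mn] /=.
    by rewrite inE eqxx.
  by rewrite inE mn orbT.
have ufar m n : (m < n)%N -> e < operator_gap (u_ n) (u_ m).
  by move=> mn; have [_] := gP (st n); apply; [exact: st_mem|].
have [|s [f [sS fS sf]]] := @Tcpt u_.
  have [M [Mr MK]] := Kb; exists M; split=> // M' MM' _ [n _ <-].
  exact: MK.
pose e' := e / (2 `^ p * 2).
have e'0 : 0 < e' by rewrite divr_gt0// mulr_gt0// powR_gt0.
have [n0 _ Hn] := sf e' e'0.
have := ufar _ _ (sS _ _ (ltnSn n0)); apply/negP; rewrite -leNgt.
apply: le_trans (modular_triangle (TS _) fS (TS _)) _.
have h1 := Hn n0.+1 (leqnSn _); have h2 := Hn n0 (leqnn _).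
rewrite /= modular_distC in h2; rewrite /= in h1.
apply: (@le_trans _ _ (2 `^ p * (e' + e'))).
  by apply: ler_wpM2l (lerD h1 h2); exact: powR_ge0.
rewrite (_ : _ * _ = e' * (2 `^ p * 2)); last by ring.
by rewrite /e' divfK// mulf_neq0 ?gt_eqF// powR_gt0.
Qed.

(** A compact operator turns weak convergence into convergence. Some ball around a
    point [w0] belongs to [F]; it is convex, so that [u] is in its closure, hence
    is not much farther from [w0] than the points of the ball. *)
Lemma operator_weak_cvg (K : set X) (F : set_system X) u :
  bounded_set K -> UltraFilter F -> F K ->
  (forall C, F C -> convex_set C -> closure C u) ->
  forall e : R, 0 < e -> F [set w | operator_gap w u <= e].
Proof.
move=> Kb FU FK Fu e e0.
pose q : R := 2 `^ p.
have q0 : 0 < q by exact: powR_gt0.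
pose L := q * (1 + q * 2).
have L0 : 0 < L by apply: mulr_gt0 => //; apply: addr_gt0 => //; exact: mulr_gt0.
pose e' := e / L.
have e'0 : 0 < e' by exact: divr_gt0.
have [w0 Kw0 Fw0] := operator_totally_bounded Kb FU FK e'0.
have [r r0 Hr] := operator_continuous u e'0.
have /(_ _ (nbhsx_ballx _ _ r0))[w1 [/= w1w0 uw1]] := Fu _ Fw0 (@operator_ball_convex w0 e').
have w1u : operator_gap w1 u <= e' by apply: Hr; rewrite -ball_normE in uw1.
have uw0 : operator_gap u w0 <= q * (e' + e').
  apply: le_trans (modular_triangle (TS _) (TS w1) (TS _)) _.
  rewrite /operator_gap modular_distC in w1u.
  by apply: ler_wpM2l (lerD w1u w1w0); exact: powR_ge0.
rewrite /operator_gap modular_distC in uw0.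
apply: filterS Fw0 => w /= ww0.
apply: le_trans (modular_triangle (TS _) (TS w0) (TS _)) _.
apply: (@le_trans _ _ (q * (e' + q * (e' + e')))).
  by apply: ler_wpM2l (lerD ww0 uw0); exact: powR_ge0.
rewrite (_ : q * _ = e' * L); last by rewrite /L; ring.
by rewrite /e' divfK// gt_eqF.
Qed.

End compact_operator.

(** * Convex functions and Minty's method *)

Lemma convex_combination_seq (R : realType) (M : lmodType R) (C : set M)
    (I : eqType) (s : seq I) (a : I -> R) (v : I -> M) :
  convex_set C -> (forall i, 0 <= a i) -> (forall i, C (v i)) ->
  \sum_(i <- s) a i = 1 -> C (\sum_(i <- s) a i *: v i).
Proof.
move=> /convex_setP cC a0 Cv.
elim: s a a0 => [|i s IH] a a0; first by rewrite big_nil => /esym/eqP; rewrite oner_eq0.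
rewrite !big_cons => ai1.
have s0 : 0 <= \sum_(i <- s) a i by apply: sumr_ge0.
have [sE|sN] := eqVneq (\sum_(i <- s) a i) 0.
  rewrite sE addr0 in ai1; rewrite ai1 scale1r.
  have /eqP := sE; rewrite psumr_eq0// => /allP sz.
  rewrite big_seq big1 ?addr0// => l ls.
  by have /= /eqP -> := sz l ls; rewrite scale0r.
have sE : \sum_(i <- s) a i = 1 - a i by rewrite -ai1 addrC addKr.
rewrite sE in sN s0.
have -> : \sum_(l <- s) a l *: v l =
    (1 - a i) *: \sum_(l <- s) (a l / (1 - a i)) *: v l.
  rewrite scaler_sumr; apply: eq_bigr => l _.
  by rewrite scalerA mulrC divfK.
apply: cC => //; last by rewrite a0/= -subr_ge0.
apply: IH => [l|]; first by rewrite divr_ge0.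
by rewrite -mulr_suml sE divff.
Qed.

Definition combination (R : realType) (M : lmodType R) (m : nat) (v : 'I_m -> M)
  (x : 'rV[R]_m) : M := \sum_i x ord0 i *: v i.

Lemma convex_combination (R : realType) (M : lmodType R) (C : set M) m
    (v : 'I_m -> M) x :
  convex_set C -> simplex x -> (forall i, C (v i)) -> C (combination v x).
Proof. by move=> cC [x0 x1] Cv; apply: convex_combination_seq. Qed.

Lemma combination_continuous (R : realType) (X : normedModType R) m (v : 'I_m -> X) :
  continuous (combination v).
Proof.
move=> x; apply: (@cvg_big _ _ _ _ _ (@add_continuous X) _ (nbhs x)) => i _.
by apply: (@cvgZr_tmp _ _ _ (nbhs x)); exact: coord_continuous.
Qed.

Section sublevel.
Context (R : realType) (X : normedModType R) (phi : X -> \bar R).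
Hypothesis phi_proper : forall u, (-oo < phi u)%E.
Hypothesis phi_convex : convex_ereal phi.
Hypothesis phi_lsc : lower_semicontinuous phi.

Lemma effective_fin u : effective_domain phi u -> phi u = (fine (phi u))%:E.
Proof. by move=> uD; rewrite fineK// fin_numElt phi_proper. Qed.

Lemma convex_ereal_le u v (r s t : R) : 0 <= t <= 1 ->
  (phi u <= r%:E)%E -> (phi v <= s%:E)%E ->
  (phi (t *: u + (1 - t) *: v)%R <= (t * r + (1 - t) * s)%:E)%E.
Proof.
move=> /andP[t0 t1] ur vs.
have [->|tN0] := eqVneq t 0; first by rewrite scale0r mul0r subr0 scale1r mul1r !add0r.
have [->|tN1] := eqVneq t 1; first by rewrite subrr scale0r mul0r scale1r mul1r !addr0.
have t0' : 0 < t by rewrite lt_neqAle eq_sym tN0.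
have t1' : t < 1 by rewrite lt_neqAle tN1.
apply: (le_trans (phi_convex _ _ _)); first by rewrite t0'.
rewrite [leRHS](_ : _ = t%:E * r%:E + (1 - t)%:E * s%:E)%E//.
apply: leeD; apply: lee_wpmul2l => //.
by rewrite lee_fin subr_ge0.
Qed.

Lemma sublevel_convex (r : R) : convex_set [set u | (phi u <= r%:E)%E].
Proof.
apply/convex_setP => u v t /= ur vr t01.
by have := convex_ereal_le t01 ur vr; rewrite -mulrDl (addrC t) subrK mul1r.
Qed.

Lemma sublevel_closed (r : R) : closed [set u | (phi u <= r%:E)%E].
Proof.
rewrite (_ : [set u | _] = ~` [set u | (r%:E < phi u)%E]); last first.
  apply/seteqP; split=> u /=; first by move=> ur; apply/negP; rewrite -leNgt.
  by move=> /negP; rewrite -leNgt.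
by apply: open_closedC; exact: (lower_semicontinuousP phi).1.
Qed.

(** Stated over the product space in order that Jensen's inequality be the instance of
    [convex_combination] for the epigraph. *)
Lemma epigraph_convex :
  convex_set [set ur : X * R^o | (phi ur.1 <= ur.2%:E)%E].
Proof.
by apply/convex_setP => -[u r] [v s] t /= ur vs t01; exact: convex_ereal_le.
Qed.

Lemma Jensen m (v : 'I_m -> X) x : simplex x ->
  (forall i, effective_domain phi (v i)) ->
  (phi (combination v x) <= (\sum_i x ord0 i * fine (phi (v i)))%:E)%E.
Proof.
move=> xS vD.
have := convex_combination (v := fun i => (v i, fine (phi (v i)) : R^o)) epigraph_convex xS.
have -> : combination (fun i => (v i, fine (phi (v i)) : R^o)) x =
    (combination v x, \sum_i x ord0 i * fine (phi (v i))).
  rewrite /combination; elim: (index_enum _) => [|i s IH]; first by rewrite !big_nil.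
  by rewrite !big_cons IH.
by apply=> i /=; rewrite -effective_fin.
Qed.

End sublevel.

Section minty.
Context (R : realType) (X : normedModType R).
Context (K : set X) (A : X -> set (X -> R)) (phi : X -> \bar R) (J : X -> X -> R).
Hypothesis X_reflexive : reflexive_space X.
Hypothesis K_bounded : bounded_set K.
Hypothesis K_closed : closed K.
Hypothesis K_convex : convex_set K.
Hypothesis A_dual : forall u, K u -> A u `<=` @dual R X.
Hypothesis A_nonempty : forall u, K u -> A u !=set0.
Hypothesis A_monotone : monotone_on K A.
Hypothesis A_lhc : lower_hemicontinuous_on K A.
Hypothesis phi_proper : forall u, (-oo < phi u)%E.
Hypothesis phi_convex : convex_ereal phi.
Hypothesis phi_lsc : lower_semicontinuous phi.
Hypothesis phi_K : effective_domain phi `&` K !=set0.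
Hypothesis J_combination : forall m (v : 'I_m -> X) x, simplex x ->
  0 <= \sum_i x ord0 i * J (combination v x) (v i).
Hypothesis J_segment : forall u v (t : R), 0 < t ->
  J u (u + t *: (v - u)) <= t * J u v.
Hypothesis J_usc : forall u v (c : R), J u v < c ->
  exists2 r : R, 0 < r & forall u', `|u - u'| < r -> J u' v <= c.
Hypothesis J_weak_usc : forall F u, UltraFilter F -> F K ->
  (forall C, F C -> convex_set C -> closure C u) ->
  forall v (c : R), J u v < c -> F [set w | J w v <= c].

Definition minty_test (a : X * (X -> R)) :=
  [/\ K a.1, effective_domain phi a.1 & A a.1 a.2].

(** The form [a.2] belongs to [A] at the test point [a.1] and not at [u]: this is
    Minty's variant of the inequality, which unlike the original one survives
    weak limits. *)
Definition minty_gap (a : X * (X -> R)) u : R :=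
  a.2 (a.1 - u) + fine (phi a.1) + J u a.1.

Definition minty_set (a : X * (X -> R)) : set X :=
  [set u | (phi u <= (minty_gap a u)%:E)%E].

(** The bound [minty_gap a] is upper semicontinuous and [phi] is lower semicontinuous. *)
Lemma minty_set_closed a : minty_test a -> closed (minty_set a).
Proof.
move=> [Ka aD aA]; have [al ac] := A_dual Ka aA.
move=> u uG; rewrite /minty_set /=; apply/lee_addgt0Pr => e e0.
rewrite -EFinD; apply: (sublevel_closed phi_lsc) => U /nbhs_ballP[r /= r0 rU].
have [|r1 r10 H1] := @J_usc u a.1 (J u a.1 + e / 2); first by rewrite ltrDl divr_gt0.
have e20 : 0 < e / 2 by rewrite divr_gt0.
have /cvgrPdist_le/(_ _ e20)/nbhs_ballP[r2 /= r20 H2] := ac u.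
have m0 : 0 < Num.min r (Num.min r1 r2) by rewrite !lt_min r0 r10.
have [w [wG]] := uG _ (nbhsx_ballx u _ m0).
rewrite -ball_normE /= !lt_min => /and3P[wr wr1 wr2].
exists w; split; last by apply: rU; rewrite -ball_normE.
apply: le_trans wG _; rewrite lee_fin /minty_gap !scalar_formB//.
have := H1 w wr1; have := H2 w; rewrite -ball_normE /= => /(_ wr2).
by rewrite ler_norml; lra.
Qed.

(** Apply the Knaster-Kuratowski-Mazurkiewicz theorem to the coefficients of convex
    combinations. If a combination [u] failed every test that it involves, then by
    monotonicity it would also fail them with a single [us] in [A u] instead of
    the forms at the test points. The weighted sum of these failures contradicts
    Jensen's inequality and [J_combination]. *)
Lemma minty_finite m (a : 'I_m -> X * (X -> R)) : (0 < m)%N ->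
  (forall i, minty_test (a i)) ->
  exists2 u, K u & forall i, minty_set (a i) u.
Proof.
move=> m0 aT; pose v i := (a i).1.
have vK x : simplex x -> K (combination v x).
  by move=> xS; apply: convex_combination => // i; case: (aT i).
have [|x xS|x xS xG] := @KKM R m (fun i => combination v @^-1` minty_set (a i)) m0.
- by move=> i; apply: (continuous_closedP _).1 (minty_set_closed (aT i));
    exact: combination_continuous.
- apply: contrapT => nx; set u := combination v x in nx.
  have uK : K u by exact: vK.
  have [us uA] := A_nonempty uK; have [ul _] := A_dual uK uA.
  have uphi : (phi u <= (\sum_i x ord0 i * fine (phi (v i)))%:E)%E.
    by apply: Jensen => // i; case: (aT i).
  have uD : effective_domain phi u by apply: le_lt_trans uphi _; rewrite ltry.
  rewrite (effective_fin phi_proper uD) lee_fin in uphi.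
  set f := fine (phi u) in uphi.
  have [x0 x1] := xS.
  have gap i : 0 < x ord0 i ->
      us (v i - u) + fine (phi (v i)) + J u (v i) < f.
    move=> xi; rewrite ltNge; apply/negP => fle; apply: nx; exists i => //=.
    rewrite /minty_set /= -/u (effective_fin phi_proper uD) lee_fin.
    apply: le_trans fle _; rewrite /minty_gap !lerD2r.
    have [vKi _ vA] := aT i.
    by have := A_monotone uK vKi uA vA; rewrite subr_ge0.
  have [i xi] : exists i, 0 < x ord0 i.
    apply: contrapT => nxi; have : \sum_i x ord0 i = 0.
      apply: big1 => i _; apply/le_anti; rewrite x0 andbT leNgt.
      by apply/negP => xi; apply: nxi; exists i.
    by rewrite x1 => /eqP; rewrite oner_eq0.
  have gap_pos : 0 < \sum_i x ord0 i *
      (f - (us (v i - u) + fine (phi (v i)) + J u (v i))).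
    rewrite (bigD1 i)//= ltr_pwDl ?mulr_gt0 ?subr_gt0 ?gap//.
    apply: sumr_ge0 => l _; have := x0 l; rewrite le_eqVlt => /predU1P[<-|xl].
      by rewrite mul0r.
    by rewrite ltW// mulr_gt0// subr_gt0 gap.
  have us0 : \sum_i x ord0 i * us (v i - u) = 0.
    under eq_bigr do rewrite (scalar_formB _ _ ul) mulrBr.
    rewrite sumrB -mulr_suml x1 mul1r.
    rewrite [in X in _ - X]/u /combination.
    rewrite (big_morph us (fun a b => scalar_formD a b ul) (scalar_form0 ul)).
    by apply/eqP; rewrite subr_eq0; apply/eqP/eq_bigr => l _; rewrite (scalar_formZ _ _ ul).
  have J0 := J_combination v xS.
  move: gap_pos; under eq_bigr do rewrite mulrBr !mulrDr.
  rewrite sumrB -mulr_suml x1 mul1r !big_split /= us0 -/u.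
  by rewrite -/u in J0; lra.
- by exists (combination v x) => [|i]; [exact: vK|exact: xG].
Qed.

(** By the finite case, the sets of points of [K] that pass finitely many tests
    generate a filter; take an ultrafilter that refines it, and its weak limit
    [u]. Along it, [J] and the linear forms are asymptotically at most their
    values at [u], and the sublevel sets of [phi] are convex and closed. *)
Lemma minty_solution : exists2 u, K u & forall a, minty_test a -> minty_set a u.
Proof.
pose B := [set P : set X | exists m (a : 'I_m -> X * (X -> R)),
  (forall i, minty_test (a i)) /\
  forall u, K u -> (forall i, minty_set (a i) u) -> P u].
have [v0 [v0D Kv0]] := phi_K; have [us0 Av0] := A_nonempty Kv0.
have BF : ProperFilter B.
  split; last split.
  - move=> [m [a [aT aP]]].
    have [m0|m0] := posnP m.
      by apply: (aP v0) => // i; have := ltn_ord i; rewrite {2}m0.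
    by have [u Ku ua] := minty_finite m0 aT; exact: (aP u).
  - by exists 0%N, (fun=> (v0, us0)); split=> // -[].
  - move=> P Q [m1 [a1 [aT1 aP1]]] [m2 [a2 [aT2 aP2]]].
    exists (m1 + m2)%N, (fun i => match fintype.split i with inl l => a1 l | inr l => a2 l end).
    split=> [i|u Ku H]; first by case: (fintype.split i).
    split.
      by apply: aP1 => // i; have := H (unsplit (inl i)); rewrite unsplitK.
    by apply: aP2 => // i; have := H (unsplit (inr i)); rewrite unsplitK.
  - by move=> P Q PQ [m [a [aT aP]]]; exists m, a; split=> // u Ku H; apply/PQ/aP.
have [F [FU BFsub]] := ultraFilterLemma BF.
have FK : F K.
  by apply: BFsub; exists 0%N, (fun=> (v0, us0)); split=> // -[].
have FG a : minty_test a -> F (minty_set a).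
  by move=> aT; apply: BFsub; exists 1%N, (fun=> a); split=> // u _ /(_ ord0).
have [u Fu uC] := reflexive_ultrafilter X_reflexive K_bounded FU FK.
exists u => [|a aT]; first by apply: K_closed; exact: uC.
have [Ka aD aA] := aT; have [al ac] := A_dual Ka aA.
rewrite /minty_set /=; apply/lee_addgt0Pr => e e0; rewrite -EFinD.
apply: (sublevel_closed phi_lsc); apply: (uC); last exact: sublevel_convex.
have e20 : 0 < e / 2 by rewrite divr_gt0.
have FJ : F [set w | J w a.1 <= J u a.1 + e / 2].
  by apply: (J_weak_usc FU FK uC); rewrite ltrDl.
have Fa : F [set w | `|a.2 u - a.2 w| <= e / 2].
  by have /cvgrPdist_le/(_ _ e20) := Fu _ (conj al ac).
apply: filterS (filterI (FG a aT) (filterI FJ Fa)) => w [/= wG [wJ wa]].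
apply: le_trans wG _; rewrite lee_fin /minty_gap !scalar_formB//.
by move: wa; rewrite ler_norml; lra.
Qed.

(** Minty's trick: apply the tests at the points [w n] of the segment from [u] to [v]
    that tend to [u], and divide by [t n]. Lower hemicontinuity provides test
    forms at [w n] that tend to any prescribed [us] in [A u], which is why one [us]
    serves all the [v]. *)
Theorem hemivariational_solution : exists2 u, K u /\ effective_domain phi u &
  forall us, A u us -> forall v, K v -> effective_domain phi v ->
    fine (phi u) <= us (v - u) + fine (phi v) + J u v.
Proof.
have [u Ku uM] := minty_solution.
have [v0 [v0D Kv0]] := phi_K; have [us0 Av0] := A_nonempty Kv0.
have uD : effective_domain phi u.
  have /uM : minty_test (v0, us0) by [].
  by move=> /le_lt_trans; apply; rewrite ltry.
exists u => // us uA v Kv vD.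
pose t n : R := n.+1%:R^-1.
have t0 n : 0 < t n by rewrite invr_gt0.
have t1 n : t n <= 1 by rewrite invf_le1// ler1n.
pose w n := (1 - t n) *: u + t n *: v.
have wE n : w n = u + t n *: (v - u).
  by rewrite /w scalerBl scale1r scalerBr addrAC -addrA.
have segK : line_segment u v `<=` K.
  move=> _ [s /= + <-]; rewrite in_itv /= => /andP[s0 s1].
  have := (convex_setP K).1 K_convex u v (1 - s) Ku Kv.
  by rewrite subKr; apply; rewrite subr_ge0 s1 gerBl.
have w_seg n : line_segment u v (w n).
  by exists (t n) => //=; rewrite in_itv /= t1 ltW.
have w_cvg : w n @[n --> \oo] --> u.
  rewrite (_ : w = fun n => u + t n *: (v - u)); last exact/funext.
  have : u + t n *: (v - u) @[n --> \oo] --> u + (0 : R) *: (v - u).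
    by apply: cvgD; [exact: cvg_cst|apply: cvgZr_tmp; exact: cvg_harmonic].
  by rewrite scale0r addr0.
have u_seg : line_segment u v u.
  exists 0 => /=; first by rewrite in_itv /= lexx ler01.
  by rewrite subr0 scale1r scale0r addr0.
have [us_ [us_A us_cvg]] := A_lhc segK u_seg uA w_seg w_cvg.
have main n : fine (phi u) <= us_ n (v - u) + fine (phi v) + J u v.
  have Kw : K (w n) by exact: segK.
  have [nl _] := A_dual Kw (us_A n).
  have wphi : (phi (w n) <= ((1 - t n) * fine (phi u) + t n * fine (phi v))%:E)%E.
    have := @convex_ereal_le _ _ _ phi_convex u v (fine (phi u)) (fine (phi v)) (1 - t n).
    rewrite subKr; apply; rewrite -?effective_fin//.
    by rewrite subr_ge0 t1 gerBl ltW.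
  have wD : effective_domain phi (w n) by apply: le_lt_trans wphi _; rewrite ltry.
  have : minty_set (w n, us_ n) u by apply: uM; split=> //; exact: us_A.
  rewrite /minty_set /= (effective_fin phi_proper uD) lee_fin /minty_gap /=.
  rewrite (effective_fin phi_proper wD) lee_fin in wphi.
  have wu : w n - u = t n *: (v - u) by rewrite wE addrAC subrr add0r.
  rewrite wu (scalar_formZ _ _ nl).
  have := J_segment u v (t0 n); rewrite -wE => Jw H.
  have : t n * fine (phi u) <=
      t n * (us_ n (v - u) + fine (phi v) + J u v) by rewrite !mulrDr; lra.
  by rewrite ler_pM2l.
have lim_cvg : us_ n (v - u) + fine (phi v) + J u v @[n --> \oo] -->
    us (v - u) + fine (phi v) + J u v.
  by do 2 (apply: cvgD; last exact: cvg_cst); exact: us_cvg.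
rewrite -(cvg_lim _ lim_cvg)//; apply: limr_ge; first exact: cvgP lim_cvg.
exact: nearW.
Qed.

End minty.

(** * The hemivariational inequality *)

(** The growth condition on the gradient turns into one on the derivative, in terms
    of the sup norm on which the modular is based. *)
Lemma clarke_growth_mxnorm (R : realType) (k : nat) (p C : R)
    (f : 'rV[R]_k -> R) (y h : 'rV[R]_k) :
  1 < p -> 0 <= C -> locally_lipschitz f ->
  (forall z, clarke_gradient f y z -> enorm z <= C * (1 + enorm y `^ (p - 1))) ->
  `|clarke_fine f y h| <=
    k%:R * C * (1 + k%:R `^ (p - 1)) * ((1 + `|y| `^ (p - 1)) * `|h|).
Proof.
move=> p1 C0 fL growth.
rewrite (le_trans (clarke_growth fL h growth))// !mulrA ler_wpM2r//.
rewrite -!mulrA !ler_wpM2l//.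
have p10 : 0 <= p - 1 by rewrite subr_ge0 ltW.
have h1 : enorm y `^ (p - 1) <= k%:R `^ (p - 1) * `|y| `^ (p - 1).
  by rewrite -powRM//; apply: powR_le => //; [exact: sqrtr_ge0|exact: enorm_le_mxnorm].
have h2 := powR_ge0 (k%:R : R) (p - 1); have h3 := powR_ge0 `|y| (p - 1).
by rewrite mulrDl mul1r mulrDr mulr1; lra.
Qed.

Lemma ae_imply d (S : measurableType d) (R : realType)
    (mu : {measure set S -> \bar R}) (P Q : S -> Prop) :
  (forall x, P x -> Q x) -> {ae mu, forall x, P x} -> {ae mu, forall x, Q x}.
Proof. by move=> PQ; exact: filterS. Qed.

Unset Implicit Arguments.
Set Strict Implicit.

Theorem theorem2 (R : realType) (X : completeNormedModType R)
  (K : set X) (A : X -> set (X -> R)) (phi : X -> \bar R)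
  (p : R) (N k : nat) (Omega : set 'rV[R]_N.+1)
  (T : X -> 'rV[R]_N.+1 -> 'rV[R]_k) (j : 'rV[R]_N.+1 -> 'rV[R]_k -> R)
  (hX : reflexive_space X)
  (hp : 1 < p) (hk : (0 < k)%N)
  (hOmega_open : open Omega) (hOmega_bounded : bounded_set Omega)
  (hK_nonempty : K !=set0) (hK_bounded : bounded_set K)
  (hK_closed : closed K) (hK_convex : convex_set K)
  (hA_dual : forall u, K u -> A u `<=` @dual R X)
  (hA_nonempty : forall u, K u -> A u !=set0)
  (hA_monotone : monotone_on K A)
  (hA_lhc : lower_hemicontinuous_on K A)
  (hphi_proper : forall u, (-oo < phi u)%E)
  (hphi_convex : convex_ereal phi)
  (hphi_lsc : lower_semicontinuous phi)
  (hphi_K : effective_domain phi `&` K !=set0)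
  (hT_linear : Lp_linear Omega p T)
  (hT_compact : Lp_compact Omega p T)
  (hj : caratheodory_function Omega j)
  (hj_lip : forall x, Omega x -> locally_lipschitz (j x))
  (hj_growth : exists2 C : R, 0 < C &
     {ae lebesgue_rV R N, forall x, Omega x ->
        forall y z : 'rV[R]_k, clarke_gradient (j x) y z ->
          enorm z <= C * (1 + enorm y `^ (p - 1))}) :
  exists u us, K u /\ A u us /\
    forall v, K v ->
      (0 <= (us (v - u)%R)%:E + phi v - phi u +
        \int[lebesgue_rV R N]_(x in Omega)
          clarke_derivative (j x) (T u x) (T v x - T u x)%R)%E.
Proof.
pose mu := lebesgue_rV R N.
have mO : measurable (Omega : set (lebesgue_rV_type R N)).
  exact: open_lebesgue_measurable.
have finO : (mu Omega < +oo)%E by exact: bounded_lebesgue_finite.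
have TS u : modular_space mu Omega p (T u).
  exact: (in_Lp_modular_space mO hp (hT_linear.1 u)).
have Tlin := hT_linear.2.
have Tcpt (u_ : nat -> X) : bounded_set (range u_) ->
    exists (s : nat -> nat) f, [/\ {homo s : m n / (m < n)%N},
      modular_space mu Omega p f & forall e : R, 0 < e -> \forall n \near \oo,
        modular mu Omega p (fun x => T (u_ (s n)) x - f x) <= e].
  move=> /hT_compact[s [f [sS [fp sf]]]]; exists s, f.
  have fS : modular_space mu Omega p f by exact: in_Lp_modular_space.
  split=> // e e0; pose r := e `^ p^-1.
  have r0 : 0 < r by exact: powR_gt0.
  have nr : nbhs 0%E [set x : \bar R | (x < r%:E)%E].
    by apply: open_nbhs_nbhs; split; [exact: open_ereal_lt_ereal|rewrite /= lte_fin].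
  have H : \forall n \near \oo,
      (Lp_norm Omega p (fun x => T (u_ (s n)) x - f x)%R < r%:E)%E by exact: sf _ nr.
  apply: filterS H => n nlt.
  have pN : p != 0 by rewrite gt_eqF// (lt_trans _ hp).
  rewrite -[leRHS](powR_invK pN (ltW e0)); apply: modular_le_Lp_norm => //.
  - exact: modular_spaceB.
  - exact: ltW.
  - exact: ltW nlt.
have [C C0 hC] := hj_growth.
pose L := k%:R * C * (1 + k%:R `^ (p - 1)).
have L0 : 0 <= L by rewrite /L !mulr_ge0 ?(ltW C0)// addr_ge0 ?powR_ge0.
have jL : {ae mu, forall x, Omega x -> forall y h,
    `|clarke_fine (j x) y h| <= L * ((1 + `|y| `^ (p - 1)) * `|h|)}.
  apply: ae_imply hC => x Hx Ox y h.
  by apply: clarke_growth_mxnorm => //; [exact: ltW|exact: hj_lip|exact: Hx].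
pose J u v := clarke_integral mu Omega j (T u) (fun x => T v x - T u x).
have TB u v : modular_space mu Omega p (fun x => T v x - T u x).
  exact: modular_spaceB.
have usc u v c : J u v < c -> exists2 e : R, 0 < e & forall u',
    operator_gap mu Omega p T u' u <= e -> J u' v <= c.
  move=> /(clarke_integral_usc mO finO hp hj.1 hj_lip L0 jL (TS u) (TS v))[e e0 He].
  by exists e => // u'; exact: He.
have [||||u [Ku uD] uP] := @hemivariational_solution R X K A phi J hX hK_bounded
  hK_closed hK_convex hA_dual hA_nonempty hA_monotone hA_lhc hphi_proper
  hphi_convex hphi_lsc hphi_K.
- move=> m v x [x0 x1].
  apply: (clarke_integral_combination mO finO hp hj.1 hj_lip L0 jL) => //.
  apply: ae_imply (operator_ae_sum Tlin (fun i => x ord0 i) v) => y Ty Oy.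
  under eq_bigr do rewrite scalerBr.
  by rewrite sumrB -scaler_suml x1 scale1r /combination Ty// subrr.
- move=> u v t t0.
  apply: (clarke_integral_scale mO finO hp hj.1 hj_lip L0 jL) => //.
  apply: filterS2 (Tlin t (v - u) u) (operator_aeB Tlin v u) => x H1 H2 Ox.
  by rewrite (addrC u) H1// H2// addrK.
- move=> u v c /usc[e e0 He].
  have [r r0 Hr] := operator_continuous mO hp TS Tlin Tcpt u e0.
  by exists r => // u' uu'; apply/He/Hr.
- move=> F u FU FK Fu v c /usc[e e0 He].
  apply: filterS (operator_weak_cvg mO hp TS Tlin Tcpt hK_bounded FU FK Fu e0).
  by move=> w; exact: He.
have [us uA] := hA_nonempty u Ku; exists u, us; split=> //; split=> // v Kv.
have -> : (\int[lebesgue_rV R N]_(x in Omega)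
    clarke_derivative (j x) (T u x) (T v x - T u x)%R = (J u v)%:E)%E.
  rewrite /J /clarke_integral -EFin_Rintegral//; last first.
    exact: (clarke_integrable mO finO hp hj.1 hj_lip L0 jL).
  apply: eq_integral => x /set_mem Ox; rewrite clarke_fineE//.
  exact: hj_lip.
rewrite (effective_fin hphi_proper uD).
have [vD|vD] := pselect (effective_domain phi v).
  rewrite (effective_fin hphi_proper vD) lee_fin.
  by have := uP us uA v Kv vD; lra.
have -> : phi v = +oo%E by apply/eqP; rewrite -leye_eq leNgt; apply/negP.
by rewrite addey// -EFinN !addye// leey.
Qed.
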